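(* In the ring of formal power series $\mathbb{C}[[\underline t]]$ in countably many indeterminates $\underline t=(t_j)_{j\ge 1}$, \[ \sum_{n \ge 0} \sum_{\lambda \in EP(n)} \sum_{\nu \vdash n} \operatorname{sign}(\nu)\,\psi_{S_n}^\lambda(\nu)\, \frac{\underline t^{c(\nu)}}{|Z_\nu|} = \prod_{p \ge 0} \left( \frac{1 + t_{2^p}}{1 - t_{2^p}} \right)^{1/2^{p+1}} . \]
   Context: For $n$ even, $EP(n)$ is the set of all partitions of $n$ with even parts only ($EP(0)$ consists of the empty partition, and the $n=0$ term of the sum equals $1$); for $n$ odd, $EP(n)$ is the set of all partitions of $n$ with all parts even except for a single part of size $1$. For a partition $\nu\vdash n$ with $b_j$ parts of size $j$ ($j\ge1$), $\underline t^{c(\nu)} := \prod_j t_j^{b_j}$, $|Z_\nu| = \prod_j b_j!\, j^{b_j}$ is the size of the centralizer in $S_n$ of an element of cycle type $\nu$, and $\operatorname{sign}(\nu)$ is the sign of a permutation of cycle type $\nu$. $\psi(\nu)$ denotes the value of the character $\psi$ on elements of cycle type $\nu$. Fractional powers are the formal power series with constant term $1$. Higher Lie characters of $S_n$: let $\lambda \vdash n$ have $a_i$ parts of size $i$ ($i\ge 1$), and let $x \in S_n$ have cycle type $\lambda$. Write $x=\prod_i x_i$ where $x_i$ is the product of the $a_i$ cycles of $x$ of length $i$. The centralizer is $Z_x = Z_{S_n}(x) = \prod_i Z_{S_{ia_i}}(x_i) \cong \prod_i G_i \wr S_{a_i}$, with $G_i$ cyclic of order $i$. Concretely, label the $ia_i$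 points lying in cycles of length $i$ by $(r,t)$, $1\le r\le a_i$, $t \in \mathbb{Z}/i\mathbb{Z}$, so that $x(r,t)=(r,t+1)$; every element $z_i\in Z_{S_{ia_i}}(x_i)$ has the form $z_i(r,t)=(\sigma(r),t+k_r)$ with $\sigma\in S_{a_i}$, $k_r\in\mathbb{Z}/i\mathbb{Z}$. Let $\omega_i$ be the linear character that is a primitive (faithful) irreducible character on the cyclic group $G_i$ and trivial on $S_{a_i}$, i.e. $\omega_i(z_i)=\prod_r \zeta_i^{k_r}$ with $\zeta_i$ a primitive complex $i$-th root of unity. Let $\omega^x := \bigotimes_i \omega_i$, a linear character of $Z_x$. The higher Lie character is the induced character $\psi_{S_n}^\lambda = \psi_{S_n}^x := \omega^x\uparrow_{Z_x}^{S_n}$; it depends only on $\lambda$. *)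

(* Defs.v *)
From HB Require Import structures.
From mathcomp Require Import all_boot all_order all_fingroup all_algebra.
From mathcomp Require Import all_solvable all_field all_character.
From mathcomp Require Import finmap boolp monalg.

Set Implicit Arguments.
Unset Strict Implicit.
Unset Printing Implicit Defensive.

Import GRing.Theory Num.Theory.

Local Open Scope ring_scope.

Local Notation "1" := (@mone _) : monom_scope.
Local Notation "x * y" := (mmul x y) : monom_scope.

Section Factorizations.
Variable I : choiceType.
Implicit Types m : {cmonom I}.

(* All pairs (a, b) of monomials with a * b = m, each listed once: a divisor
   of m has its support in that of m, with exponents at most those of m. *)
Definition mbound m : nat := \max_(i : finsupp m) m (val i).

Definition mfact m : seq ({cmonom I} * {cmonom I}) :=
  [seq p : {cmonom I} * {cmonom I} <- undup [seq (a, divcm m a) |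
         a <- [seq [cmonom (d i : nat) | i : finsupp m]%M |
               d : {ffun finsupp m -> 'I_(mbound m).+1}]]
   | (p.1 * p.2)%M == m].

Lemma mfact_uniq m : uniq (mfact m).
Proof. by rewrite filter_uniq ?undup_uniq. Qed.

Lemma mem_mfact m (p : {cmonom I} * {cmonom I}) :
  (p \in mfact m) = ((p.1 * p.2)%M == m).
Proof.
rewrite mem_filter; case: eqP => //= def_m; rewrite mem_undup.
apply/mapP; exists p.1; last first.
  case: p def_m => a b /= <-; congr (_, _); apply/eqP/cmP => i.
  by rewrite divcmE cmM addKn.
have lemk i : (p.1 i <= m i)%N by rewrite -def_m cmM leq_addr.
apply/imageP.
exists [ffun i : finsupp m => inord (p.1 (val i))] => //.
apply/eqP/cmP => i; rewrite cmE fsfun_ffun.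
case: insubP => [j _ <-|]; last first.
  by rewrite -cmE_eq0 => /eqP mi0; apply/eqP; rewrite -leqn0; have := lemk i; rewrite mi0.
rewrite /= ffunE inordK // ltnS (leq_trans (lemk _)) //.
exact: (leq_bigmax (F := fun i : finsupp m => m (val i))).
Qed.

End Factorizations.

(* Formal power series in the commuting indeterminates indexed by I: arbitrary
   families of coefficients, indexed by the (finitely supported) monomials. *)
Record fps (I : choiceType) (R : Type) := Fps {fpscoef :> {cmonom I} -> R}.
Bind Scope ring_scope with fps.

HB.instance Definition _ (I : choiceType) (R : Type) := gen_eqMixin (fps I R).
HB.instance Definition _ (I : choiceType) (R : Type) :=
  gen_choiceMixin (fps I R).

Section FpsRing.
Variables (I : choiceType) (R : comNzRingType).
Local Notation F := (fps I R).
Implicit Types f g h : F.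

Lemma fpsP f g : (forall m, f m = g m) <-> f = g.
Proof.
split=> [|-> //]; case: f g => [f] [g] /= fg.
by congr Fps; apply/funext.
Qed.

Definition fps0 : F := Fps (fun=> 0).
Definition fpsN f : F := Fps (fun m => - f m).
Definition fpsD f g : F := Fps (fun m => f m + g m).
Definition fpsmono (m : {cmonom I}) : F := Fps (fun k => (k == m)%:R).
Definition fpsM f g : F := Fps (fun m => \sum_(p <- mfact m) f p.1 * g p.2).

Fact fpsDA : associative fpsD.
Proof. by move=> f g h; apply/fpsP => m /=; rewrite addrA. Qed.
Fact fpsDC : commutative fpsD.
Proof. by move=> f g; apply/fpsP => m /=; rewrite addrC. Qed.
Fact fps0D : left_id fps0 fpsD.
Proof. by move=> f; apply/fpsP => m /=; rewrite add0r. Qed.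
Fact fpsND : left_inverse fps0 fpsN fpsD.
Proof. by move=> f; apply/fpsP => m /=; rewrite addNr. Qed.

HB.instance Definition _ := GRing.isZmodule.Build F fpsDA fpsDC fps0D fpsND.

Fact fpsMC : commutative fpsM.
Proof.
move=> f g; apply/fpsP => m /=.
pose swap (p : {cmonom I} * {cmonom I}) := (p.2, p.1).
rewrite (perm_big (map swap (mfact m))) /=.
  by rewrite big_map; apply: eq_bigr => p _; rewrite mulrC.
apply: uniq_perm; rewrite ?mfact_uniq // ?map_inj_uniq ?mfact_uniq //.
  by move=> [a b] [c d] [-> ->].
move=> [a b]; rewrite -[(a, b)]/(swap (b, a)) mem_map; last first.
  by move=> [a1 b1] [c d] [-> ->].
by rewrite !mem_mfact /= mulmC.
Qed.

Fact fps1M : left_id (fpsmono 1%M) fpsM.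
Proof.
move=> f; apply/fpsP => m /=.
rewrite (bigD1_seq (1%M, m)) ?mfact_uniq ?mem_mfact ?mul1m //=.
rewrite eqxx mul1r big_seq_cond big1 ?addr0 // => -[a b] /=.
rewrite mem_mfact /= => /andP[/eqP <-].
by case: (eqVneq a 1%M) => [->|]; rewrite ?mul1m ?eqxx // mul0r.
Qed.

Fact fpsMA : associative fpsM.
Proof.
move=> f g h; apply/fpsP => m /=; pose T := {cmonom I}.
have memT (s : seq (T * T)) t (u : {p : T * T & (T * T)%type}) :
    u \in [seq existT _ p q | p <- s, q <- t p] -> tagged u \in t (tag u).
  by case/allpairsPdep => p [q [_ qt ->]].
pose G (q : T * T * T) := f q.1.1 * g q.1.2 * h q.2.
pose s1 := [seq ((p.1, q.1), q.2) : T * T * T | p <- mfact m, q <- mfact p.2].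
pose s2 := [seq ((q.1, q.2), p.2) : T * T * T | p <- mfact m, q <- mfact p.1].
transitivity (\sum_(q <- s1) G q).
  rewrite big_allpairs_dep; apply: eq_bigr => p _; rewrite mulr_sumr.
  by apply: eq_bigr => q _; rewrite mulrA.
transitivity (\sum_(q <- s2) G q); last first.
  rewrite big_allpairs_dep; apply: eq_bigr => p _; rewrite mulr_suml.
  by apply: eq_bigr => q _.
apply: perm_big; apply: uniq_perm.
- apply: allpairs_uniq_dep => [|p _|]; rewrite ?mfact_uniq //.
  move=> [[a b] [c d]] [[a' b'] [c' d']] /memT + /memT /=.
  by rewrite !mem_mfact => /eqP /= <- /eqP /= <- [-> -> ->].
- apply: allpairs_uniq_dep => [|p _|]; rewrite ?mfact_uniq //.
  move=> [[a b] [c d]] [[a' b'] [c' d']] /memT + /memT /=.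
  by rewrite !mem_mfact => /eqP /= <- /eqP /= <- [-> -> ->].
move=> [[a b] c]; transitivity ((a * b * c)%M == m).
  apply/allpairsPdep/eqP => [[p [q [+ + [-> -> ->]]]]|<-].
    by rewrite !mem_mfact => /eqP <- /eqP <-; rewrite mulmA.
  by exists (a, (b * c)%M), (b, c); rewrite !mem_mfact /= mulmA !eqxx.
apply/esym; apply/allpairsPdep/eqP => [[p [q [+ + [-> -> ->]]]]|<-].
  by rewrite !mem_mfact => /eqP <- /eqP <-.
by exists ((a * b)%M, c), (a, b); rewrite !mem_mfact /= !eqxx.
Qed.

Fact fpsMDl : left_distributive fpsM fpsD.
Proof.
move=> f g h; apply/fpsP => m /=; rewrite -big_split /=.
by apply: eq_bigr => p _; rewrite mulrDl.
Qed.

Fact fps1_neq0 : fpsmono 1%M != 0 :> F.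
Proof.
apply/eqP => /fpsP/(_ 1%M) /=; rewrite eqxx; apply/eqP; exact: oner_neq0.
Qed.

HB.instance Definition _ :=
  GRing.Zmodule_isComNzRing.Build F fpsMA fpsMC fps1M fpsMDl fps1_neq0.

Definition fpsZ (c : R) f : F := Fps (fun m => c * f m).

Fact fpsZA a b f : fpsZ a (fpsZ b f) = fpsZ (a * b) f.
Proof. by apply/fpsP => m /=; rewrite mulrA. Qed.
Fact fps1Z : left_id 1 fpsZ.
Proof. by move=> f; apply/fpsP => m /=; rewrite mul1r. Qed.
Fact fpsZDr : right_distributive fpsZ +%R.
Proof. by move=> a f g; apply/fpsP => m /=; rewrite mulrDr. Qed.
Fact fpsZDl f : {morph fpsZ^~ f : a b / a + b}.
Proof. by move=> a b; apply/fpsP => m /=; rewrite mulrDl. Qed.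

HB.instance Definition _ :=
  GRing.Zmodule_isLmodule.Build R F fpsZA fps1Z fpsZDr fpsZDl.

Fact fpsZAl (a : R) f g : a *: (f * g) = (a *: f) * g.
Proof.
apply/fpsP => m /=; rewrite mulr_sumr.
by apply: eq_bigr => p _; rewrite mulrA.
Qed.

HB.instance Definition _ := GRing.Lmodule_isLalgebra.Build R F fpsZAl.
HB.instance Definition _ := GRing.Lalgebra_isComAlgebra.Build R F.

Definition fps_unit : {pred F} := fun f => `[< exists g, g * f = 1 >].
Definition fps_inv f : F :=
  if pselect (exists g, g * f = 1) is left invf then projT1 (cid invf) else f.

Fact fps_mulVf : {in fps_unit, left_inverse 1 fps_inv *%R}.
Proof.
move=> f /asboolP invf; rewrite /fps_inv.
by case: pselect => // e; apply: (projT2 (cid e)).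
Qed.
Fact fps_unitPl f g : g * f = 1 -> fps_unit f.
Proof. by move=> gf; apply/asboolP; exists g. Qed.
Fact fps_inv_out : {in [predC fps_unit], fps_inv =1 id}.
Proof.
by move=> f /asboolPn invf; rewrite /fps_inv; case: pselect.
Qed.

HB.instance Definition _ :=
  GRing.ComNzRing_hasMulInverse.Build F fps_mulVf fps_unitPl fps_inv_out.

(* f^(1/k), the k-th root of f with constant term 1 (unique for k > 0 over a field of
   characteristic 0); the value 0 is a default when f has no such root. *)
Definition fps_root (k : nat) f : F :=
  if pselect (exists g, g 1%M = 1 /\ g ^+ k = f) is left rootf
  then projT1 (cid rootf) else 0.

(* Convergence in the usual topology of the ring of power series: each
   coefficient is eventually constant. *)
Definition fps_cvg (u : nat -> F) f :=
  forall m, exists N, forall n, (N <= n)%N -> u n m = f m.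

Lemma fps_cvg_unique (u : nat -> F) f g : fps_cvg u f -> fps_cvg u g -> f = g.
Proof.
move=> uf ug; apply/fpsP => m; have [N uN] := uf m; have [M uM] := ug m.
by rewrite -(uN (maxn N M)) ?leq_maxl // (uM (maxn N M)) ?leq_maxr.
Qed.

End FpsRing.

Definition is_intpart (n : nat) (s : seq nat) : bool :=
  [&& sorted geq s, 0%N \notin s & sumn s == n].

Record intpart (n : nat) : predArgType :=
  IntPart {ipval :> seq nat; _ : is_intpart n ipval}.

HB.instance Definition _ (n : nat) := [isSub for @ipval n].
HB.instance Definition _ n := [Countable of intpart n by <:].

Section IntPartFinite.
Variable n : nat.

Fact intpart_bounds (la : intpart n) :
  (size la <= n)%N && all (fun j => j <= n)%N la.
Proof.
case: la => s /= /and3P[_ s0 /eqP <-].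
elim: s s0 => //= j s IHs; rewrite inE negb_or eq_sym -lt0n => /andP[j0 /IHs].
move=> /andP[le_s /allP s_le]; rewrite leq_addr -add1n leq_add //=.
by apply/allP => i /s_le /leq_trans; apply; rewrite leq_addl.
Qed.

Definition intpart_bseq (la : intpart n) : n.-bseq 'I_n.+1 :=
  insub_bseq n [seq inord j | j <- la].

Fact intpart_bseqK :
  pcancel intpart_bseq (fun b => insub [seq val i | i <- b]).
Proof.
move=> la; have /andP[le_s /allP s_le] := intpart_bounds la.
have -> : intpart_bseq la = [seq inord j | j <- la] :> seq _.
  by rewrite /intpart_bseq /insub_bseq val_insubd size_map le_s.
rewrite -map_comp (_ : map _ _ = la) ?valK // -[RHS]map_id.
by apply/eq_in_map => j /s_le le_jn /=; rewrite inordK.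
Qed.

HB.instance Definition _ :=
  isFinite.Build (intpart n) (pcan_enumP intpart_bseqK).
End IntPartFinite.

Definition nparts (j : nat) (s : seq nat) : nat := count_mem j s.

Definition EP (n : nat) : {set intpart n} :=
  [set la : intpart n |
    if odd n then (nparts 1 la == 1) && all (fun j => (j == 1) || ~~ odd j) la
    else all (fun j => ~~ odd j) la]%N.

(* |Z_nu|, the order of the centralizer of a permutation of cycle type nu. *)
Definition zcard (n : nat) (nu : intpart n) : nat :=
  \prod_(1 <= j < n.+1) ((nparts j nu)`! * j ^ nparts j nu)%N.

Definition has_cycle_type (n : nat) (s : 'S_n) (la : seq nat) : bool :=
  perm_eq [seq #|pred_of_set c| | c <- enum (porbits s)] la.

Fact ex_cycle_type_seq n (la : seq nat) :
  0%N \notin la -> sumn la = n -> exists s : 'S_n, has_cycle_type s la.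
Proof.
move=> la0 sum_la; pose k := size la; pose l (i : 'I_k) := nth 0%N la i.
have l_gt0 i : (0 < l i)%N.
  by rewrite lt0n; apply: contra la0 => /eqP <-; apply: mem_nth.
pose T := {i : 'I_k & 'I_(l i)}.
have map_l : [seq l i | i <- enum 'I_k] = la.
  by rewrite -[RHS](mkseq_nth 0%N) /mkseq -val_enum_ord -map_comp.
have {sum_la} : #|{: T}| = n.
  rewrite card_tagged -sum_la -map_l; congr sumn.
  by apply: eq_map => i; rewrite card_ord.
move=> <-.
pose rot (u : T) : T := Tagged (fun i => 'I_(l i)) (ordS (tagged u)).
have eqT (u v : T) : tag u = tag v -> val (tagged u) = val (tagged v) -> u = v.
  by case: u v => [i a] [j b] /= ij; case: j / ij b => b /val_inj ->.
have rot_inj : injective rot.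
  move=> [i a] [j b] uv; have /= ij := congr1 tag uv.
  case: j / ij b uv => b /eqP.
  by rewrite -tag_eqE /tag_eq /= eqxx tagged_asE => /eqP/ordS_inj ->.
have f_inj : injective (enum_rank \o rot \o enum_val : 'I_#|{: T}| -> _).
  by move=> y z /= /enum_rank_inj/rot_inj/enum_val_inj.
pose s := perm f_inj; exists s.
have sE j u : iter j s (enum_rank u) = enum_rank (iter j rot u).
  by elim: j => //= j ->; rewrite permE /= enum_rankK.
have tag_rot j u : tag (iter j rot u) = tag u by elim: j.
have val_rot j (u : T) : val (tagged (iter j rot u)) = 
    ((val (tagged u) + j) %% l (tag u))%N.
  elim: j => [|j IHj]; first by rewrite addn0 modn_small ?ltn_ord.
  by rewrite /= IHj tag_rot -addn1 modnDml addn1 addnS.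
pose B i : {set 'I_#|{: T}|} := [set y | tag (enum_val y) == i].
have porbitE y : porbit s y = B (tag (enum_val y)).
  apply/setP => z; rewrite inE; apply/porbitP/eqP => [[j ->]|eq_tag].
    by rewrite -[y in LHS]enum_valK permX sE enum_rankK tag_rot.
  rewrite -(enum_valK z) -(enum_valK y).
  move: (enum_val y) (enum_val z) eq_tag => [i a] [j b] /= eq_ji.
  case: i / eq_ji a => a; exists (b + (l j - a))%N; rewrite permX sE.
  congr enum_rank; apply: eqT; rewrite ?tag_rot // val_rot /=.
  by rewrite addnCA subnKC 1?ltnW // modnDr modn_small.
have defB i : B i = [set enum_rank (Tagged _ a : T) | a : 'I_(l i)].
  apply/setP => y; rewrite inE; apply/eqP/imsetP => [<-|[a _ ->]].
    by exists (tagged (enum_val y)); rewrite // -[LHS]enum_valK; case: enum_val.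
  by rewrite enum_rankK.
have cardB i : #|B i| = l i.
  rewrite defB card_imset ?card_ord // => a b /enum_rank_inj/eqP.
  by rewrite -tag_eqE /tag_eq /= eqxx tagged_asE => /eqP.
have inB i (a : 'I_(l i)) : enum_rank (Tagged _ a : T) \in B i.
  by rewrite inE enum_rankK.
have B_inj : injective B.
  move=> i j eqB; have := inB i (Ordinal (l_gt0 i)).
  by rewrite eqB inE enum_rankK => /eqP.
have perm_B : perm_eq (enum (porbits s)) [seq B i | i <- enum 'I_k].
  apply: uniq_perm => [||c]; rewrite ?(map_inj_uniq B_inj) ?enum_uniq //.
  rewrite mem_enum; apply/imsetP/mapP => [[y _ ->]|[i _ ->]].
    by exists (tag (enum_val y)); rewrite ?mem_enum.
  exists (enum_rank (Tagged _ (Ordinal (l_gt0 i)) : T)) => //.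
  by rewrite porbitE enum_rankK.
rewrite /has_cycle_type (perm_trans (perm_map _ perm_B)) //.
by rewrite -map_comp -[in X in perm_eq _ X]map_l (eq_map cardB).
Qed.

Fact ex_cycle_type n (la : intpart n) : exists s : 'S_n, has_cycle_type s la.
Proof.
by case: la => l /= /and3P[_ l0 /eqP suml]; apply: ex_cycle_type_seq.
Qed.

Definition perm_of_type (n : nat) (la : intpart n) : 'S_n :=
  xchoose (ex_cycle_type la).

Fact perm_of_typeP n (la : intpart n) : has_cycle_type (perm_of_type la) la.
Proof. exact: (xchooseP (ex_cycle_type la)). Qed.

Definition prim_root_family (zeta : nat -> algC) : Prop :=
  forall i, (0 < i)%N -> i.-primitive_root (zeta i).

Section HigherLie.
Variables (zeta : nat -> algC) (zetaP : prim_root_family zeta).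
Variables (n : nat) (x : 'S_n).
Implicit Types (z w : 'S_n) (r : 'I_n).

(* In each cycle of x of length i, the point labelled (r, t) is x^t r, where r
   is the representative of the cycle given by froot x. If z commutes with x
   then z (x^t r) = x^(t + k) r', where r' := froot x (z r) and k := cshift z r;
   so sigma maps r to r' and k_r = k. *)
Definition cshift z r : nat := findex x (froot x (z r)) (z r).

Definition omega_val z : algC :=
  \prod_(r | froots x r) zeta (fingraph.order x r) ^+ cshift z r.

Let xsym := fconnect_sym (@perm_inj _ x).

Fact cent_iter z j r : z \in 'C[x]%g -> z (iter j x r) = iter j x (z r).
Proof.
move=> /cent1P zx; elim: j => //= j <-.
by have /permP/(_ (iter j x r)) := zx; rewrite !permM.
Qed.

Fact order_cent z r : z \in 'C[x]%g -> fingraph.order x (z r) = fingraph.order x r.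
Proof.
have le_o w u : w \in 'C[x]%g -> (fingraph.order x (w u) <= fingraph.order x u)%N.
  move=> wx; rewrite /fingraph.order -(card_image (@perm_inj _ w) (fconnect x u)).
  apply/subset_leq_card/subsetP => y; rewrite -topredE /= => /iter_findex <-.
  rewrite -cent_iter //; apply: image_f; exact: fconnect_iter.
move=> zx; apply/eqP; rewrite eqn_leq le_o //=.
by rewrite -{1}(permK z r) le_o ?groupV.
Qed.

Fact froot_cshift z r : iter (cshift z r) x (froot x (z r)) = z r.
Proof. by apply: iter_findex; rewrite xsym connect_root. Qed.

Fact iter_modn j r : iter j x r = iter (j %% fingraph.order x r) x r.
Proof.
rewrite {1}(divn_eq j (fingraph.order x r)) addnC iterD; congr iter.
elim: (_ %/ _)%N => // k IHk.
by rewrite mulSn addnC iterD iter_order //; apply: perm_inj.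
Qed.

Fact froot_iter j r : froot x (iter j x r) = froot x r.
Proof. by apply/esym/eqP; rewrite root_connect // fconnect_iter. Qed.

Fact order_froot r : fingraph.order x (froot x r) = fingraph.order x r.
Proof.
apply: eq_card => y; rewrite !inE.
by rewrite -(same_connect xsym (connect_root _ r)).
Qed.

Fact omega_val_cent z w :
  z \in 'C[x]%g -> w \in 'C[x]%g -> omega_val (z * w)%g = omega_val z * omega_val w.
Proof.
move=> zx wx; pose sg u r := froot x ((u : 'S_n) r).
have sgM u v r : v \in 'C[x]%g -> sg (u * v)%g r = sg v (sg u r).
  move=> vx; rewrite /sg permM -{1}(froot_cshift u r) cent_iter //.
  by rewrite froot_iter.
have sg_id r : froots x r -> sg 1%g r = r.
  by rewrite /sg perm1 => /eqP.
have order_sg u r : u \in 'C[x]%g -> fingraph.order x (sg u r) = fingraph.order x r.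
  by move=> ux; rewrite order_froot order_cent.
have sg_roots u r : froots x (sg u r) by exact: roots_root.
rewrite [omega_val w](reindex_onto (sg z) (sg z^-1%g)) /=; last first.
  by move=> r rr; rewrite -sgM // mulVg sg_id.
rewrite [X in _ * X](eq_bigl (froots x)); last first.
  move=> r; rewrite sg_roots /= -sgM ?groupV // mulgV.
  apply/eqP/idP => [<-|/sg_id //]; exact: roots_root.
rewrite -big_split /=; apply: eq_bigr => r rr.
rewrite order_sg // -exprD.
have o_gt0 : (0 < fingraph.order x r)%N by apply: fingraph.order_gt0.
apply/eqP; rewrite (eq_prim_root_expr (zetaP o_gt0)); apply/eqP.
set s := sg w (sg z r).
have os : fingraph.order x s = fingraph.order x r by rewrite !order_sg.
have zwr : (z * w)%g r = iter (cshift z r + cshift w (sg z r)) x s.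
  by rewrite permM -{1}(froot_cshift z r) cent_iter // -froot_cshift -iterD.
have -> : cshift (z * w)%g r = ((cshift z r + cshift w (sg z r)) %% fingraph.order x r)%N.
  rewrite /cshift -/(sg _ r) sgM // -/s zwr iter_modn os.
  by rewrite findex_iter ?os ?ltn_pmod.
by rewrite modn_mod.
Qed.

Fact omega_is_class_fun :
  is_class_fun <<'C[x]>>%g [ffun z => omega_val z *+ (z \in 'C[x]%g)].
Proof.
rewrite genGid; apply: intro_class_fun => [z w zx wx | z /negPf -> //].
rewrite groupJ // zx /= conjgE !omega_val_cent ?groupM ?groupV //.
rewrite mulrCA -!omega_val_cent ?groupM ?groupV //.
by rewrite mulVg mulg1.
Qed.

Definition omega : 'CF('C[x]) := Cfun 0 omega_is_class_fun.

Definition higher_lie : 'CF([set: 'S_n]) := 'Ind[[set: 'S_n]] omega.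

End HigherLie.

(* The value of psi^la on permutations of cycle type nu. *)
Definition psi (zeta : nat -> algC) (zetaP : prim_root_family zeta) (n : nat)
    (la nu : intpart n) : algC :=
  higher_lie zetaP (perm_of_type la) (perm_of_type nu).

Definition sign_of_type (n : nat) (nu : intpart n) : algC :=
  (-1) ^+ perm_of_type nu.

(* The indeterminate t_j, for j >= 1; the variables of fps nat algC are
   indexed from 0, so that t_j is variable number j - 1. *)
Definition tvar (j : nat) : fps nat algC := fpsmono algC (ucm j.-1).

(* Main.v *)
Require Import Defs.
From mathcomp Require Import all_boot all_order all_fingroup all_algebra.
From mathcomp Require Import all_solvable all_field all_character.
From mathcomp Require Import zify ring.
From mathcomp Require Import finmap monalg.

(* Summing psi^la over la in EP(n) and evaluating at g of cycle type nu gives the sum of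
   omega_x(g) over the x commuting with g whose cycles are all even, up to one fixed point.
   As omega_x(g) is a product over the orbits of <x, g>, this sum is computed by exploring
   the orbit of a point a: x is determined by c = x a and an element of the centralizer
   of g that fixes the g-cycle of c, and bypassing that cycle leaves the other orbits
   unchanged. For a fixed number m of g-cycles (of length l) met by the orbit of a, the
   contributions of the orbit, summed over the l possible return points, form a sum over
   all l-th roots of unity of given parity of order, hence equal
   [l = 1] - [m odd and l a power of 2]. The sum is thus a product over l of numbers given
   by a three-term recursion in the number of l-cycles; it vanishes unless every l is a
   power of 2, and otherwise matches the recursion for the coefficients of
   ((1 + t) / (1 - t))^(1 / (2l)). *)

Set Implicit Arguments.
Unset Strict Implicit.
Unset Printing Implicit Defensive.

Import GRing.Theory Num.Theory.
Local Open Scope ring_scope.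
Local Notation ord := fingraph.order.
Local Notation "1" := (@mone _) : monom_scope.
Local Notation "x * y" := (mmul x y) : monom_scope.

(** * Sums of roots of unity *)

(** Two choices make the recursion close up. The sum runs over centralizer elements supported on an
    arbitrary [g]-stable set [A]: removing a [g]-cycle stays within this family, and the sum depends
    on [A] only through its cycle counts. The weight of the orbit of [a] is kept as an arbitrary
    function of the return time [m] and the return shift [s], because bypassing a cycle lowers [m]
    by one and keeps [s]; the true weight is inserted at the end, where only its sum over [s]
    matters. The cycle representatives in [omega_val] are arbitrary, compatible neither with [g] nor
    with conjugation; in both places their contributions cancel in a product over cycles. Length 1
    is special: an isolated fixed point of [x] is also fixed by [g] and can be removed from the
    support, which produces the factor 1 + t of ((1 + t) / (1 - t))^(1/2) = (1 + t) (1 -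
    t^2)^(-1/2). For l = 2^p > 1 the recursion alone yields the inverse of the wanted series; the
    sign -1 of each cycle of even length replaces t by -t and corrects this. *)

Section RootsOfUnity.
Variable C : fieldType.

Lemma primitive_root_unique (m n : nat) (z : C) :
  m.-primitive_root z -> n.-primitive_root z -> m = n.
Proof.
move=> zm zn; apply/eqP; rewrite eqn_dvd (prim_order_dvd zm) (prim_order_dvd zn).
by rewrite !prim_expr_order ?eqxx.
Qed.

Lemma sum_prim_root_expr (n : nat) (z : C) :
  n.-primitive_root z -> \sum_(j < n) z ^+ j = (n == 1%N)%:R.
Proof.
move=> zn; have zn1 := prim_expr_order zn.
have [n1|n1] := eqVneq n 1%N.
  by rewrite n1 big_ord1 expr0.
have /eqP : (z - 1) * (\sum_(j < n) z ^+ j) = 0 by rewrite -subrX1 zn1 subrr.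
rewrite mulf_eq0 subr_eq0 => /orP[/eqP z1|/eqP -> //].
have := prim_order_dvd zn 1; rewrite z1 expr1 eqxx dvdn1.
by rewrite (negPf n1).
Qed.

End RootsOfUnity.

(** Write l = e g with g the gcd. If e is odd, the 2-part of l is coprime to e, so it divides g.
    Conversely, if g absorbs the 2-part, then e divides the odd part of l. *)
Lemma odd_div_gcd (j l : nat) : (0 < l)%N -> odd (l %/ gcdn j l) = (l`_2%N %| j)%N.
Proof.
move=> l_gt0; have q_dvd := dvdn_part 2%N l.
have g_gt0 : (0 < gcdn j l)%N by rewrite gcdn_gt0 l_gt0 orbT.
have lE := divnK (dvdn_gcdr j l); set e := (l %/ _)%N in lE *.
apply/idP/idP => [odd_e|q_j].
  apply: dvdn_trans (dvdn_gcdl j l).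
  have co : coprime l`_2%N e by rewrite p_part coprimeXl // coprime2n.
  by move: q_dvd; rewrite -[X in (_ %| X)%N]lE Gauss_dvdr.
have /dvdnP[u gE] : (l`_2%N %| gcdn j l)%N by rewrite dvdn_gcd q_j.
have : (e %| l`_(2^')%N)%N.
  rewrite -(@dvdn_pmul2l l`_2%N) ?part_gt0 // partnC // -[X in (_ %| X)%N]lE gE.
  by rewrite mulnC dvdn_mul // dvdn_mull.
case/dvdnP => v vE; have : odd l`_(2^')%N by rewrite odd_2'nat part_pnat.
by rewrite vE oddM => /andP[].
Qed.

(* The contribution to omega_x(g) of an orbit of <x, g>, killed when its x-cycles are odd,
   when the x-orbit of a point a of a g-cycle of length l first returns to that cycle after
   m steps, at g^s a: the orbit then has d = gcdn s l x-cycles, of length m (l / d), and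
   g^d a = x^(m u) a, where s u = d modulo l. *)
Definition orbit_weight (zeta : nat -> algC) (m l s : nat) : algC :=
  let i := (m * (l %/ gcdn s l))%N in
  (~~ odd i)%:R * zeta i ^+ (m * (egcdn s l).1)%N.

Definition shift_sum (l m : nat) : algC :=
  (l == 1%N)%:R - (odd m && (2.-nat l)%N)%:R.

(* The root of unity in orbit_weight is an injective function of s with values in the l-th
   roots of unity, and its order l / gcdn s l decides the parity, so no Moebius function
   is needed. *)
Lemma sum_orbit_weight (zeta : nat -> algC) (zetaP : prim_root_family zeta)
    (l m : nat) : (0 < l)%N -> (0 < m)%N ->
  \sum_(s < l) orbit_weight zeta m l s = shift_sum l m.
Proof.
move=> l_gt0 m_gt0; pose rho := zeta l; have rhoP : l.-primitive_root rho := zetaP l l_gt0.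
pose e s := (l %/ gcdn s l)%N.
have g_gt0 s : (0 < gcdn s l)%N by rewrite gcdn_gt0 l_gt0 orbT.
have lE s : (e s * gcdn s l = l)%N by rewrite divnK ?dvdn_gcdr.
have e_gt0 s : (0 < e s)%N.
  by have := lE s; case: (e s) => //; rewrite mul0n => E; rewrite -E in l_gt0.
pose u s := (egcdn s l).1; pose h s := zeta (m * e s)%N ^+ (m * u s).
have etaP s : (e s).-primitive_root (zeta (m * e s)%N ^+ m).
  have me_gt0 : (0 < m * e s)%N by rewrite muln_gt0 m_gt0 e_gt0.
  have := dvdn_prim_root (zetaP _ me_gt0) (dvdn_mull m (dvdnn (e s))).
  by rewrite mulnK.
(* As a Bezout coefficient, [u s] inverts s / d modulo l / d, with d the gcd; this allows s to be
   recovered from [h s]. *)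
have uP s : ((s %/ gcdn s l) * u s = 1 %[mod e s])%N.
  case: (posnP s) => [->|s_gt0].
    by rewrite /e gcd0n divnn l_gt0 !modn1.
  rewrite /u; case: egcdnP => //= a b ab _.
  have dE := divnK (dvdn_gcdl s l).
  have -> : (s %/ gcdn s l * a = b * e s + 1)%N.
    apply/eqP; rewrite -(eqn_pmul2r (g_gt0 s)) mulnAC dE mulnDl -mulnA lE mul1n.
    by rewrite mulnC ab.
  by rewrite modnMDl.
have u_co s : coprime (u s) (e s).
  have : coprime ((s %/ gcdn s l) * u s) (e s) by rewrite -coprime_modl uP coprime_modl coprime1n.
  by rewrite coprimeMl => /andP[].
have hP s : (e s).-primitive_root (h s).
  by rewrite /h exprM prim_root_exp_coprime.
have h_inj : injective (fun s : 'I_l => h s).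
  move=> s s' hh; have ee : e s = e s'.
    by apply: primitive_root_unique (hP s) _; rewrite hh.
  have dd : gcdn s l = gcdn s' l.
    by apply/eqP; rewrite -(eqn_pmul2l (e_gt0 s)) lE ee lE.
  move: hh; rewrite /h !exprM ee => /eqP; rewrite (eq_prim_root_expr (etaP s')) => /eqP uu.
  have /eqP : (s %/ gcdn s l = s' %/ gcdn s' l %[mod e s'])%N.
    set A := (s %/ _)%N; set B := (s' %/ _)%N.
    have AE : (A * (B * u s') = A %[mod e s'])%N by rewrite -modnMmr (uP s') modnMmr muln1.
    have BE : (B * (A * u s) = B %[mod e s'])%N.
      by rewrite -ee -modnMmr (uP s) modnMmr muln1.
    rewrite -[LHS]AE -[RHS]BE mulnCA -[LHS]modnMmr -[X in (B * X)%N]modnMmr -uu.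
    by rewrite modnMmr mulnA modnMmr -mulnA.
  have lt_e (r : 'I_l) : (r %/ gcdn r l < e r)%N by rewrite ltn_divLR // lE.
  rewrite -{1}ee (modn_small (lt_e s)) (modn_small (lt_e s')).
  move=> /eqP ss; apply: val_inj => /=.
  by rewrite -[LHS](divnK (dvdn_gcdl s l)) -[RHS](divnK (dvdn_gcdl s' l)) ss dd.
(* All [h s] are l-th roots of unity, so [j] is an injective self-map of a finite set, hence a
   permutation along which the sum is reindexed. *)
have /fin_all_exists[j jP] (s : 'I_l) : exists j : 'I_l, h s = rho ^+ j.
  have /(prim_rootP rhoP)[i ->] : h s ^+ l = 1; last by exists i.
  by rewrite -[X in _ ^+ X](lE s) exprM (prim_expr_order (hP s)) expr1n.
have j_inj : injective j.
  by move=> s s' ejj; apply: h_inj; rewrite !jP ejj.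
have eE (s : 'I_l) : e s = e (j s).
  by apply: primitive_root_unique (hP s) _; rewrite jP; apply: exp_prim_root.
have -> : \sum_(s < l) orbit_weight zeta m l s =
    \sum_(k < l) (~~ odd (m * e k))%:R * rho ^+ k.
  rewrite [RHS](reindex_inj j_inj) /=; apply: eq_bigr => s _.
  by rewrite -eE -jP.
have sumT := sum_prim_root_expr rhoP.
have [m_odd|m_even] := boolP (odd m); last first.
  rewrite /shift_sum (negPf m_even) subr0 -sumT; apply: eq_bigr => k _.
  by rewrite oddM (negPf m_even) mul1r.
rewrite /shift_sum m_odd /= -sumT; apply/eqP; rewrite eq_sym subr_eq; apply/eqP.
rewrite -[RHS]addrC.
(* The powers of [rho] of odd order are those whose exponent is a multiple of the 2-part q of l.
   They are the powers of a primitive root of order l / q, so they sum to 0 unless l = q. *)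
have -> : (2.-nat l)%N%:R = \sum_(k < l) (odd (e k))%:R * rho ^+ k :> algC.
  pose q := (l`_2)%N; have q_gt0 : (0 < q)%N by rewrite part_gt0.
  have qo : (q * (l %/ q) = l)%N by rewrite mulnC divnK ?dvdn_part.
  have -> : (2.-nat l)%N = (l %/ q == 1)%N.
    rewrite -(eqn_pmul2l q_gt0) qo muln1; apply/idP/eqP => [l2|->]; last exact: part_pnat.
    by rewrite /q part_pnat_id.
  have rqP : (l %/ q)%N.-primitive_root (rho ^+ q).
    have /(dvdn_prim_root rhoP) : (l %/ q %| l)%N by rewrite -[X in (_ %| X)%N]qo dvdn_mull.
    have o_gt0 : (0 < l %/ q)%N by rewrite divn_gt0 // dvdn_leq // dvdn_part.
    have -> // : (l %/ (l %/ q))%N = q.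
    apply/eqP; rewrite -(eqn_pmul2r o_gt0) qo divnK //.
    by rewrite -[X in (_ %| X)%N]qo dvdn_mull.
  rewrite -(sum_prim_root_expr rqP).
  under [RHS]eq_bigr => k _ do rewrite odd_div_gcd // -/q.
  rewrite -(big_mkord xpredT (fun k => (q %| k)%:R * rho ^+ k)) -[X in index_iota _ X]qo.
  rewrite mulnC big_nat_mul big_mkord; apply: eq_bigr => k _.
  rewrite big_ltn ?ltn_mul2r ?q_gt0 ?ltnSn //= dvdn_mull // mul1r big_nat_cond big1 ?addr0.
    by rewrite mulnC exprM.
  move=> i /andP[/andP[ki ik] _]; case: dvdnP => [[v vE]|]; rewrite ?mul0r //.
  by move: ki ik; rewrite vE !ltn_pmul2r // ltnS => ki /(leq_trans ki); rewrite ltnn.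
rewrite -big_split /=; apply: eq_bigr => k _.
by rewrite oddM m_odd /=; case: odd; rewrite ?mul1r ?mul0r ?addr0 ?add0r.
Qed.

(* even_count l b is the sum of the even weights over the centralizer of a product of b
   cycles of length l. Since shift_sum l m only depends on the parity of m, bypassing two
   cycles gives a three-term recursion. *)
Fixpoint even_count (l b : nat) : algC :=
  if b is b1.+1 then
    if b1 is b2.+1 then
      shift_sum l 1 * even_count l b1 +
      (b1 * l)%:R * ((shift_sum l 2 + (b2 * l)%:R) * even_count l b2)
    else shift_sum l 1
  else 1.

(* The same sum, with the contribution of the orbit of a given point replaced by
   phi m, m being the number of cycles that it meets. *)
Fixpoint first_orbit_sum (l b : nat) (phi : nat -> algC) : algC :=
  if b is b1.+1 then
    phi 1%N * even_count l b1 +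
    (b1 * l)%:R * first_orbit_sum l b1 (fun m => phi m.+1)
  else 0.

Lemma eq_first_orbit_sum l b (phi psi : nat -> algC) :
  (forall m, (0 < m)%N -> phi m = psi m) -> first_orbit_sum l b phi = first_orbit_sum l b psi.
Proof.
elim: b phi psi => //= b IHb phi psi eq_phi; rewrite eq_phi //.
by congr (_ + _ * _); apply: IHb => m _; apply: eq_phi.
Qed.

(** The index is [b.+1] because without cycles there is no marked orbit, and the two sides would be
    0 and 1. *)
Lemma first_orbit_sum_shift l b :
  first_orbit_sum l b.+1 (shift_sum l) = even_count l b.+1.
Proof.
have [m] := ubnP b; elim: m b => // m IHm [|[|b]] le_b.
- by rewrite /= mul0r addr0 mulr1.
- by rewrite /= !mul0n !mulr1 mul0r !addr0.
have -> : first_orbit_sum l b.+3 (shift_sum l) = shift_sum l 1 * even_count l b.+2 +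
   (b.+2 * l)%:R * (shift_sum l 2 * even_count l b.+1 + (b.+1 * l)%:R *
      first_orbit_sum l b.+1 (fun m => shift_sum l m.+2)) by [].
rewrite (@eq_first_orbit_sum _ _ _ (shift_sum l)); last first.
  by move=> k _; rewrite /shift_sum /= negbK.
rewrite IHm; last by lia.
have -> : even_count l b.+3 = shift_sum l 1 * even_count l b.+2 +
   (b.+2 * l)%:R * ((shift_sum l 2 + (b.+1 * l)%:R) * even_count l b.+1) by [].
by rewrite [(shift_sum l 2 + _) * _]mulrDl.
Qed.

(* Coefficients of y = ((1 + t) / (1 - t))^(1 / (2l)), from l (1 - t^2) y' = y. *)
Fixpoint root_coef (l b : nat) : algC :=
  if b is b1.+1 then
    if b1 is b2.+1 then
      (root_coef l b1 / l%:R + b2%:R * root_coef l b2) / b%:R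
    else l%:R^-1
  else 1.

Lemma root_coefS l b : (0 < l)%N ->
  b.+2%:R * root_coef l b.+2 = root_coef l b.+1 / l%:R + b%:R * root_coef l b.
Proof. by move=> l0; rewrite [root_coef l b.+2]/= mulrC divfK // pnatr_eq0. Qed.

(** Every [shift_sum l m] vanishes, so the recursion only links b + 2 to b, with a coefficient that
    is 0 at b = 0; odd indices start from the value 0 at 1. *)
Lemma even_count_not_pow2 l b : ~~ (2.-nat l)%N -> even_count l b = (b == 0%N)%:R.
Proof.
move=> l2; have l1 : (l == 1%N) = false by apply: contraNF l2 => /eqP ->.
have s0 m : shift_sum l m = 0 by rewrite /shift_sum (negPf l2) l1 andbF subr0.
have [m] := ubnP b; elim: m b => // m IHm [|[|b]] le_b //; first by rewrite /= s0.
have -> : even_count l b.+2 = shift_sum l 1 * even_count l b.+1 +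
   (b.+1 * l)%:R * ((shift_sum l 2 + (b * l)%:R) * even_count l b) by [].
rewrite !s0 mul0r !add0r IHm; last by lia.
by case: b {IHm le_b} => [|b]; rewrite ?mul0n ?mul0r ?mulr0.
Qed.

(** The factors (-1)^b and b! l^b are the sign of b cycles of even length l and their share of
    [zcard]; both cancel in [EP_coefE]. *)
Lemma even_count_pow2 l b : (1 < l)%N -> (2.-nat l)%N ->
  even_count l b = (-1) ^+ b * (b`! * l ^ b)%:R * root_coef l b.
Proof.
move=> l_gt1 l2; have l0 : l%:R != 0 :> algC by rewrite pnatr_eq0; lia.
have l1 : (l == 1%N) = false by lia.
have s1 : shift_sum l 1 = -1 by rewrite /shift_sum l1 l2 sub0r.
have s2 : shift_sum l 2 = 0 by rewrite /shift_sum l1 subr0.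
have [m] := ubnP b; elim: m b => // m IHm [|[|b]] le_b.
- by rewrite /= !mulr1.
- by rewrite /= s1 expr1 mul1n expn1 mulfK.
have -> : even_count l b.+2 = shift_sum l 1 * even_count l b.+1 +
   (b.+1 * l)%:R * ((shift_sum l 2 + (b * l)%:R) * even_count l b) by [].
have := @root_coefS l b (ltnW l_gt1) => rE.
have -> : (-1) ^+ b.+2 * (b.+2`! * l ^ b.+2)%:R * root_coef l b.+2 =
   (-1) ^+ b * (b.+1`! * l ^ b.+2)%:R * (b.+2%:R * root_coef l b.+2).
  by rewrite factS !exprS !natrM; ring.
rewrite rE s1 s2 !IHm; [|by lia..].
rewrite factS !exprS !expnS !natrM; field.
by rewrite l0.
Qed.

(** The recursion reduces to e(c + 2) = (c + 1)^2 e(c), so e(b) / b! is the coefficient of (1 -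
    t^2)^(-1/2). The second term on the left amounts to multiplying this series by 1 + t. *)
Lemma even_count_1 b :
  even_count 1 b + b%:R * even_count 1 b.-1 = b`!%:R * root_coef 1 b.
Proof.
have s1 : shift_sum 1 1 = 0 by rewrite /shift_sum subrr.
have s2 : shift_sum 1 2 = 1 by rewrite /shift_sum subr0.
have ec c : even_count 1 c.+2 = c.+1%:R ^+ 2 * even_count 1 c.
  have -> : even_count 1 c.+2 = shift_sum 1 1 * even_count 1 c.+1 +
   (c.+1 * 1)%:R * ((shift_sum 1 2 + (c * 1)%:R) * even_count 1 c) by [].
  by rewrite s1 s2 !muln1 -!natr1; ring.
have [m] := ubnP b; elim: m b => // m IHm [|[|b]] le_b.
- by rewrite /= mul0r addr0 mulr1.
- by rewrite /= s1 add0r invr1.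
have := @root_coefS 1 b isT => rE.
have -> : b.+2`!%:R * root_coef 1 b.+2 = b.+1`!%:R * (b.+2%:R * root_coef 1 b.+2).
  by rewrite factS !natrM; ring.
rewrite rE divr1 mulrDr -IHm; last by lia.
rewrite factS natrM mulrA [_ * _ * b%:R]mulrC -mulrA.
rewrite -mulrA -[_`!%:R * root_coef 1 b]IHm ; last by lia.
case: b {IHm le_b rE} => [|b].
  by rewrite !ec /= s1; ring.
by rewrite !ec /= -!natr1; ring.
Qed.

(** * Orbits of commuting permutations *)

Section PermIter.
Variables (n : nat) (x : 'S_n).
Implicit Types (y z : 'I_n) (U : {set 'I_n}).

Lemma perm_fconnect_sym y z : fconnect x y z = fconnect x z y.
Proof. by apply: fconnect_sym; apply: perm_inj. Qed.

Lemma fconnect_iterP y z : reflect (exists j, z = iter j x y) (fconnect x y z).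
Proof.
apply: (iffP idP) => [/iter_findex <-|[j ->]]; last exact: fconnect_iter.
by exists (findex x y z).
Qed.

Lemma iter_perm_inj j : injective (iter j x).
Proof. by elim: j => //= j IHj y z /perm_inj/IHj. Qed.

Lemma eq_iter_perm y j k : (iter j x y == iter k x y) = (j == k %[mod ord x y])%N.
Proof.
have o_gt0 : (0 < ord x y)%N by apply: fingraph.order_gt0.
rewrite (iter_modn x j) (iter_modn x k); apply/eqP/eqP => [|-> //].
by move/(congr1 (findex x y)); rewrite !findex_iter ?ltn_pmod.
Qed.

Lemma iter_perm_id y j : (iter j x y == y) = (ord x y %| j)%N.
Proof. by rewrite -[X in _ == X]/(iter 0 x y) eq_iter_perm mod0n. Qed.

Lemma order_eqP y k :
  (forall j, (iter j x y == y) = (k %| j)%N) -> ord x y = k.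
Proof.
move=> yk; apply/eqP; rewrite eqn_dvd -yk iter_perm_id dvdnn /=.
by rewrite -iter_perm_id yk dvdnn.
Qed.

Lemma order_fconnect y z : fconnect x y z -> ord x z = ord x y.
Proof.
case/fconnect_iterP => j ->; apply: order_eqP => k.
by rewrite -iterD addnC iterD (inj_eq (@iter_perm_inj j)) iter_perm_id.
Qed.

Lemma froot_fconnect y z : (froot x y == froot x z) = fconnect x y z.
Proof. by apply/root_connect/perm_fconnect_sym. Qed.

Lemma froot_connect y : fconnect x (froot x y) y.
Proof. by rewrite perm_fconnect_sym connect_root. Qed.

Lemma froots_froot y : froots x (froot x y).
Proof. by apply/roots_root/perm_fconnect_sym. Qed.

Lemma froot_id_iff y : froots x y = (froot x y == y).
Proof. by []. Qed.

Lemma mem_iter U y j : (forall z, z \in U -> x z \in U) -> y \in U -> iter j x y \in U.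
Proof. by move=> Ux Uy; elim: j => //= j; apply: Ux. Qed.

Lemma mem_fconnect U y z :
  (forall z, z \in U -> x z \in U) -> fconnect x y z -> (z \in U) = (y \in U).
Proof.
move=> Ux yz; apply/idP/idP => Uz; last first.
  by case/fconnect_iterP: yz => j ->; apply: mem_iter.
by rewrite perm_fconnect_sym in yz; case/fconnect_iterP: yz => j ->; apply: mem_iter.
Qed.

End PermIter.

Section Commute.
Variables (n : nat) (x g : 'S_n).
Hypothesis cxg : g \in 'C[x]%g.

Lemma iter_comm j k y : iter j g (iter k x y) = iter k x (iter j g y).
Proof. by elim: j => //= j ->; rewrite cent_iter. Qed.

Lemma order_iter_comm k y : ord x (iter k g y) = ord x y.
Proof. by elim: k => //= k <-; rewrite (order_cent _ cxg). Qed.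

Lemma fconnect_iter_comm k y z :
  fconnect x (iter k g y) (iter k g z) = fconnect x y z.
Proof.
apply/fconnect_iterP/fconnect_iterP => -[j e]; exists j; last by rewrite e iter_comm.
by apply: (@iter_perm_inj _ g k); rewrite iter_comm.
Qed.

End Commute.

Definition gcycle n (g : 'S_n) a : {set 'I_n} := [set y | fconnect g a y].
(** For commuting [x] and [g] this is the orbit of [a] under the group they generate. In general it
    is the least [x]-stable set containing the [g]-cycle of [a], which is how it is compared with
    other sets. *)
Definition joint_orbit n (x g : 'S_n) a : {set 'I_n} :=
  [set y | [exists e, fconnect g a e && fconnect x e y]].

Section Weights.
Variables (zeta : nat -> algC) (n : nat).
Implicit Types (x g : 'S_n) (U : {set 'I_n}).

Definition root_weight x g r : algC :=
  (~~ odd (ord x r))%:R * zeta (ord x r) ^+ cshift x g r.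

(** The part of [omega_val] due to the cycles of [x] in U, killed by any odd cycle. It is meant for
    stable U, where a cycle meeting U has its root in U. *)
Definition even_weight x g U : algC :=
  \prod_(r in U | froots x r) root_weight x g r.

End Weights.

(** * The weight of a single joint orbit *)

Section OrbitWeight.
Variables (zeta : nat -> algC) (zetaP : prim_root_family zeta) (n : nat).
Variables (x g : 'S_n) (cxg : g \in 'C[x]%g) (a : 'I_n) (m s : nat).
Let l := ord g a.
Hypotheses (m_gt0 : (0 < m)%N) (s_lt : (s < l)%N) (ret : iter m x a = iter s g a).
Hypothesis first_ret : forall k, (0 < k < m)%N -> ~~ fconnect g a (iter k x a).
Let d := gcdn s l.
Let e := (l %/ d)%N.
Let l_gt0 : (0 < l)%N. Proof. exact: fingraph.order_gt0. Qed.
Let d_gt0 : (0 < d)%N. Proof. by rewrite gcdn_gt0 l_gt0 orbT. Qed.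
Let lE : (e * d = l)%N. Proof. by rewrite divnK ?dvdn_gcdr. Qed.
Let e_gt0 : (0 < e)%N. Proof. by have := l_gt0; rewrite -lE; case: e. Qed.

Let iter_ret q : iter (q * m) x a = iter (q * s) g a.
Proof.
elim: q => // q IHq; rewrite !mulSn iterD IHq -(iter_comm cxg) ret.
by rewrite -iterD addnC.
Qed.

Let ret_dvd j : fconnect g a (iter j x a) = (m %| j)%N.
Proof.
rewrite {1}(divn_eq j m) addnC iterD iter_ret -(iter_comm cxg).
rewrite -(same_connect_r (@perm_fconnect_sym _ g) (fconnect_iter _ _ _)).
have := ltn_pmod j m_gt0; rewrite /dvdn; case: (posnP (j %% m)%N) => [-> _|j_gt0 jm].
  by rewrite connect0.
by apply/negbTE/first_ret; rewrite j_gt0.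
Qed.

(** For j = q m the condition is that l divides q s; dividing by d leaves e dividing q (s / d), and
    e is coprime to s / d. *)
Let iter_id j : (iter j x a == a) = (m * e %| j)%N.
Proof.
have [/dvdnP[q ->]|mj] := boolP (m %| j)%N; last first.
  apply/eqP/idP => [ja|/(dvdn_trans (dvdn_mulr _ (dvdnn m))) mj']; last by rewrite mj' in mj.
  by rewrite -ret_dvd ja connect0 in mj.
rewrite iter_ret iter_perm_id -/l [(q * m)%N]mulnC dvdn_pmul2l //.
rewrite -lE -{1}(divnK (dvdn_gcdl s l)) -/d mulnA dvdn_pmul2r //.
rewrite Gauss_dvdl // /coprime -(eqn_pmul2r d_gt0) muln_gcdl lE divnK ?dvdn_gcdl //.
by rewrite mul1n gcdnC.
Qed.

Let ord_a : ord x a = (m * e)%N. Proof. exact: order_eqP. Qed.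

Let K := (m * (egcdn s l).1)%N.

Let iter_d : iter d g a = iter K x a.
Proof.
rewrite /K mulnC iter_ret; apply/eqP; rewrite eq_iter_perm -/l.
have [s0|s_gt0] := posnP s.
  by rewrite /d s0 gcd0n muln0 modnn mod0n.
case: egcdnP => //= u v uv _; rewrite uv modnMDl.
by [].
Qed.

(** Moving along [x] within the [g]-cycle of [a] changes the position by multiples of s, hence of d
    modulo l, and [iter_d] shows that the step d is attained. So the points g^v a with v < d
    represent the [x]-cycles of the joint orbit once each. *)
Let fconnect_g v v' :
  fconnect x (iter v g a) (iter v' g a) = (v == v' %[mod d])%N.
Proof.
apply/idP/eqP => [/fconnect_iterP[j]|vv'].
  rewrite -(iter_comm cxg) => vj.
  have /dvdnP[q jE] : (m %| j)%N.
    rewrite -ret_dvd; apply: connect_trans (fconnect_iter _ v' a) _.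
    by rewrite perm_fconnect_sym vj fconnect_iter.
  move/eqP: vj; rewrite jE iter_ret -iterD eq_iter_perm -/l => /eqP vv'.
  have dl : (d %| l)%N by rewrite dvdn_gcdr.
  rewrite -(modn_dvdm v' dl) vv' modn_dvdm // -modnDmr.
  by rewrite (eqP (dvdn_mull q (dvdn_gcdl s l))) addn0.
have red u : fconnect x (iter (u %% d) g a) (iter u g a).
  rewrite {2}(divn_eq u d) addnC iterD (fconnect_iter_comm cxg).
  elim: (u %/ d)%N => [|q IHq]; first by rewrite mul0n connect0.
  apply: connect_trans IHq _; rewrite mulSn addnC iterD (fconnect_iter_comm cxg).
  by rewrite iter_d fconnect_iter.
apply: connect_trans (red v'); rewrite -vv' perm_fconnect_sym; exact: red.
Qed.

Let r_ v := froot x (iter v g a).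
Let q_ v := findex x (r_ v) (iter v g a).

Let q_P v : iter v g a = iter (q_ v) x (r_ v).
Proof. by rewrite iter_findex // froot_connect. Qed.

Let ord_r v : ord x (r_ v) = (m * e)%N.
Proof.
rewrite -ord_a -(order_iter_comm cxg v a); apply: order_fconnect.
by rewrite perm_fconnect_sym; apply: froot_connect.
Qed.

Let me_gt0 : (0 < m * e)%N. Proof. by rewrite muln_gt0 m_gt0. Qed.

Let z := zeta (m * e)%N.
Let zP : (m * e)%N.-primitive_root z. Proof. exact: zetaP. Qed.

(** The shift of [g] at the root [r_ v] is the difference, modulo m e, of the positions of two
    consecutive points g^v a in their [x]-cycles. The product over the d roots telescopes, whichever
    roots were chosen. *)
Let z_shift v : z ^+ q_ v * z ^+ cshift x g (r_ v) = z ^+ q_ v.+1.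
Proof.
rewrite -exprD; apply/eqP; rewrite (eq_prim_root_expr zP) -(ord_r v.+1) -eq_iter_perm.
rewrite -q_P /= q_P cent_iter // iterD; apply/eqP; congr iter.
rewrite -[RHS](froot_cshift x); congr iter.
apply/eqP; rewrite froot_fconnect.
apply: etrans (fconnect_iter_comm cxg 1 (iter v g a) (r_ v)) _.
by rewrite perm_fconnect_sym; apply: froot_connect.
Qed.

Let prod_z v : z ^+ q_ 0 * \prod_(u < v) z ^+ cshift x g (r_ u) = z ^+ q_ v.
Proof.
elim: v => [|v IHv]; first by rewrite big_ord0 mulr1.
by rewrite big_ord_recr mulrA IHv z_shift.
Qed.

Let q_d : z ^+ q_ d = z ^+ q_ 0 * z ^+ K.
Proof.
rewrite -exprD; apply/eqP; rewrite (eq_prim_root_expr zP) -(ord_r d) -eq_iter_perm.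
have r0d : r_ 0 = r_ d.
  by apply/eqP; rewrite froot_fconnect fconnect_g mod0n modnn.
by rewrite -q_P addnC iterD -r0d -q_P iter_d.
Qed.

Lemma even_weight_joint_orbit :
  even_weight zeta x g (joint_orbit x g a) = orbit_weight zeta m l s.
Proof.
have r_inj : {in 'I_d &, injective (fun v : 'I_d => r_ v)}.
  move=> u v _ _ /eqP; rewrite froot_fconnect fconnect_g !modn_small ?ltn_ord //.
  by move/eqP/val_inj.
transitivity (\prod_(r in [set r_ (val v) | v in 'I_d]) root_weight zeta x g r).
  apply: eq_bigl => r; rewrite inE; apply/andP/imsetP => [[/existsP[y /andP[ay yr]] rr]|[v _ ->]].
    case/fconnect_iterP: ay => v yE; exists (Ordinal (ltn_pmod v d_gt0)) => //=.
    rewrite -[LHS](eqP rr); apply/eqP; rewrite froot_fconnect perm_fconnect_sym.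
    by apply: connect_trans yr; rewrite yE fconnect_g modn_mod.
  split; last exact: froots_froot.
  by apply/existsP; exists (iter v g a); rewrite fconnect_iter perm_fconnect_sym froot_connect.
rewrite big_imset //= /root_weight.
under eq_bigr => v _ do rewrite ord_r.
rewrite big_split /= prodr_const card_ord /orbit_weight -/d -/e -/z -/K.
have z0 : z ^+ q_ 0 != 0 by rewrite expf_neq0 // (prim_root_eq0 zP) -lt0n.
congr (_ * _).
  (* The parity indicator occurs d times; it equals its d-th power because d > 0. *)
  by case: (odd _); rewrite /= ?expr1n // expr0n eqn0Ngt d_gt0.
apply: (mulfI z0); by rewrite -q_d -(prod_z d); congr (_ * _).
Qed.
End OrbitWeight.

(** * Sums over the centralizer of a permutation *)

Section Transfer.
Variables (n : nat) (g : 'S_n) (a c : 'I_n).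
Hypothesis eq_ord : ord g c = ord g a.

(** If [c] is off the cycle of [a], the two cycles are swapped. Otherwise the cycle is rotated by
    the power of [g] taking [a] to [c], and the second branch is never taken. *)
Definition transfer_fun (y : 'I_n) : 'I_n :=
  if fconnect g a y then iter (findex g a y) g c
  else if fconnect g c y then iter (findex g c y) g a else y.

Let transfer_a j : transfer_fun (iter j g a) = iter j g c.
Proof.
rewrite /transfer_fun fconnect_iter; apply/eqP; rewrite eq_iter_perm eq_ord.
by rewrite -eq_iter_perm iter_findex ?fconnect_iter.
Qed.

Let transfer_c j : ~~ fconnect g a c -> transfer_fun (iter j g c) = iter j g a.
Proof.
rewrite /transfer_fun -(same_connect_r (@perm_fconnect_sym _ g) (fconnect_iter g j c)) => /negPf ->.
rewrite fconnect_iter; apply/eqP; rewrite eq_iter_perm -eq_ord.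
by rewrite -eq_iter_perm iter_findex ?fconnect_iter.
Qed.

Let transfer_out y : ~~ fconnect g a y -> ~~ fconnect g c y -> transfer_fun y = y.
Proof. by rewrite /transfer_fun => /negPf -> /negPf ->. Qed.

Let transfer_inj : injective transfer_fun.
Proof.
have [/fconnect_iterP[s cE]|ac] := boolP (fconnect g a c).
  have fE y : transfer_fun y = if fconnect g a y then iter s g y else y.
    rewrite /transfer_fun; case: ifP => [ay|ay].
      by rewrite cE -iterD addnC iterD iter_findex.
    by rewrite cE -(same_connect (@perm_fconnect_sym _ g) (fconnect_iter g s a)) ay.
  have fa y : fconnect g a (transfer_fun y) = fconnect g a y.
    rewrite fE; case: (boolP (fconnect g a y)) => [ay|/negPf //].
    exact: connect_trans ay (fconnect_iter _ _ _).
  move=> y y' eq_f; have := fa y; rewrite eq_f fa => yy'.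
  by move: eq_f; rewrite !fE yy'; case: ifP => // _ /iter_perm_inj.
apply: (can_inj (g := transfer_fun)) => y.
have [/fconnect_iterP[j ->]|ay] := boolP (fconnect g a y).
  by rewrite transfer_a transfer_c.
have [/fconnect_iterP[j ->]|cy] := boolP (fconnect g c y).
  by rewrite transfer_c // transfer_a.
by rewrite !transfer_out.
Qed.

Lemma ex_transfer : exists t : 'S_n, [&& t a == c,
  perm_on (gcycle g a :|: gcycle g c) t, g \in 'C[t]%g & fconnect g a c || (t c == a)].
Proof.
exists (perm transfer_inj); apply/and4P; split.
- by rewrite permE -[a in X in X == _]/(iter 0 g a) transfer_a.
- apply/subsetP => y; rewrite inE permE !inE; apply: contraR.
  by rewrite negb_or => /andP[ay cy]; rewrite transfer_out.
- apply/cent1P/permP => y; rewrite !permM !permE.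
  have [/fconnect_iterP[j ->]|ay] := boolP (fconnect g a y).
    by rewrite -[X in transfer_fun X]/(iter j.+1 g a) !transfer_a.
  have [cy|cy] := boolP (fconnect g c y).
    have ac : ~~ fconnect g a c by apply: contra ay => ac; apply: connect_trans cy.
    case/fconnect_iterP: cy => j ->.
    by rewrite -[X in transfer_fun X]/(iter j.+1 g c) !transfer_c.
  by rewrite !transfer_out // -same_fconnect1_r //; apply: perm_inj.
- by case: (boolP (fconnect g a c)) => //= ac; rewrite permE -[c in X in X == _]/(iter 0 g c) transfer_c.
Qed.

End Transfer.

(* The identity if the cycles of a and c have different lengths. *)
Definition cycle_transfer n (g : 'S_n) a c : 'S_n := odflt 1%g
  [pick t : 'S_n | [&& t a == c, perm_on (gcycle g a :|: gcycle g c) t,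
     g \in 'C[t]%g & fconnect g a c || (t c == a)]].

Section TransferTheory.
Variables (n : nat) (g : 'S_n) (a c : 'I_n).
Hypothesis eq_ord : ord g c = ord g a.
Let t := cycle_transfer g a c.

Fact transferP : [/\ t a = c, perm_on (gcycle g a :|: gcycle g c) t,
   g \in 'C[t]%g & ~~ fconnect g a c -> t c = a].
Proof.
rewrite /t /cycle_transfer; case: pickP => [u /and4P[/eqP ? ? ? ac]|].
  by split => // nac; move: ac; rewrite (negPf nac) => /eqP.
by have [u uP] := ex_transfer eq_ord => /(_ u); rewrite uP.
Qed.

End TransferTheory.

Definition centralizer_on n (g : 'S_n) (A : {set 'I_n}) : {set 'S_n} :=
  [set x : 'S_n | (g \in 'C[x]%g) && perm_on A x].

Lemma centralizer_onE n (g : 'S_n) A (x : 'S_n) :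
  (x \in centralizer_on g A) = (g \in 'C[x]%g) && perm_on A x.
Proof. by rewrite inE. Qed.

Definition stable_set n (g : 'S_n) (A : {set 'I_n}) := forall y, y \in A -> g y \in A.

Section Decomposition.
Variables (n : nat) (g : 'S_n).
Implicit Types (A : {set 'I_n}).

Lemma stable_fconnect A y z : stable_set g A -> fconnect g y z -> (z \in A) = (y \in A).
Proof. exact: mem_fconnect. Qed.

Lemma stable_gcycle c : stable_set g (gcycle g c).
Proof.
by move=> y; rewrite !inE -same_fconnect1_r //; apply: perm_inj.
Qed.

Lemma stableD A B : stable_set g A -> stable_set g B -> stable_set g (A :\: B).
Proof.
move=> gA gB y; rewrite !inE => /andP[yB yA]; rewrite gA // andbT.
by rewrite (stable_fconnect gB (fconnect1 g y)).
Qed.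

Lemma gcycle_sub A c : stable_set g A -> c \in A -> gcycle g c \subset A.
Proof. by move=> gA cA; apply/subsetP => y; rewrite inE => /(stable_fconnect gA) ->. Qed.

Lemma centralizer_onM A (x y : 'S_n) :
  x \in centralizer_on g A -> y \in centralizer_on g A -> (x * y)%g \in centralizer_on g A.
Proof.
rewrite !centralizer_onE => /andP[gx Ax] /andP[gy Ay]; rewrite perm_onM // andbT.
by rewrite cent1C; apply: groupM; rewrite cent1C.
Qed.

Lemma centralizer_onV A (x : 'S_n) : x \in centralizer_on g A -> (x^-1)%g \in centralizer_on g A.
Proof.
rewrite !centralizer_onE => /andP[gx Ax]; rewrite perm_onV // andbT.
by rewrite cent1C groupV cent1C.
Qed.

Lemma centralizer_onS A (B : {set 'I_n}) (x : 'S_n) :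
  A \subset B -> x \in centralizer_on g A -> x \in centralizer_on g B.
Proof.
by move=> AB; rewrite !centralizer_onE => /andP[-> Ax] /=; apply: subset_trans AB.
Qed.

(** Commuting with [g] and fixing [c] forces [x] to fix the [g]-cycle of [c] pointwise. *)
Lemma centralizer_on_fix A c (x : 'S_n) : x \in centralizer_on g A -> x c = c ->
  x \in centralizer_on g (A :\: gcycle g c).
Proof.
rewrite !centralizer_onE => /andP[gx Ax] xc; rewrite gx /=; apply/subsetP => y.
rewrite inE => xy; rewrite !inE (subsetP Ax) ?inE // andbT.
apply: contra xy => /fconnect_iterP[j ->].
by rewrite (cent_iter j c (_ : x \in 'C[g]%g)) ?xc // cent1C.
Qed.

(* The x with x a = c form a coset of the stabilizer of c. *)
Lemma sum_centralizer_on A a (Phi : 'S_n -> algC) : stable_set g A -> a \in A ->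
  \sum_(x in centralizer_on g A) Phi x =
  \sum_(c in A | ord g c == ord g a)
     \sum_(x in centralizer_on g (A :\: gcycle g c)) Phi (cycle_transfer g a c * x)%g.
Proof.
move=> gA aA.
rewrite (partition_big (fun x : 'S_n => x a) (fun c : 'I_n => (c \in A) && (ord g c == ord g a))) /=.
  apply: eq_bigr => c /andP[cA /eqP eq_ord]; pose t := cycle_transfer g a c.
  have [ta t_on gt _] := transferP eq_ord.
  have tA : t \in centralizer_on g A.
    by apply: (@centralizer_onS (gcycle g a :|: gcycle g c)); rewrite ?centralizer_onE ?gt // subUset !gcycle_sub.
  rewrite (reindex_inj (mulgI t)) /=; apply: eq_bigl => x.
  apply/andP/idP => [[xA /eqP xa]|xA].
    have xE : x = (t^-1 * (t * x))%g by rewrite mulKg.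
    have {}xA : x \in centralizer_on g A by rewrite xE centralizer_onM // centralizer_onV.
    apply: centralizer_on_fix xA _.
    by rewrite permM ta in xa.
  have xc : x c = c.
    move: xA; rewrite centralizer_onE => /andP[_ x_on]; apply: out_perm x_on _.
    by rewrite !inE connect0.
  split; last by rewrite permM ta xc.
  by apply: centralizer_onM => //; apply: centralizer_onS xA; apply: subsetDl.
move=> x; rewrite centralizer_onE => /andP[gx Ax]; rewrite (perm_closed _ Ax) aA.
have xg : x \in 'C[g]%g by rewrite cent1C.
by rewrite (order_cent _ xg) /=.
Qed.

End Decomposition.

Section Return.
Variables (n : nat) (g x : 'S_n) (a : 'I_n).

Lemma ex_return : exists k, (0 < k)%N && fconnect g a (iter k x a).
Proof.
exists (ord x a); rewrite fingraph.order_gt0 iter_order; last exact: perm_inj.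
by rewrite connect0.
Qed.

Definition return_time : nat := ex_minn ex_return.
Definition return_shift : nat := findex g a (iter return_time x a).

Definition is_return (m s : nat) : Prop :=
  [/\ (0 < m)%N, (s < ord g a)%N, iter m x a = iter s g a &
      forall k, (0 < k < m)%N -> ~~ fconnect g a (iter k x a)].

Lemma returnP : is_return return_time return_shift.
Proof.
rewrite /return_shift /return_time; case: ex_minnP => m /andP[m_gt0 am] m_min.
split=> //; first exact: findex_max.
  by rewrite iter_findex.
move=> k /andP[k_gt0 km]; apply: contraL km => ak.
by rewrite -leqNgt m_min // k_gt0.
Qed.

Lemma return_unique m s : is_return m s -> return_time = m /\ return_shift = s.
Proof.
case=> m_gt0 s_lt ms first_m; have [t_gt0 u_lt tu first_t] := returnP.
have tm : return_time = m.
  case: (ltngtP return_time m) => // lt.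
    by have := first_m return_time; rewrite t_gt0 lt tu fconnect_iter => /(_ isT).
  by have := first_t m; rewrite m_gt0 lt ms fconnect_iter => /(_ isT).
split=> //; move/eqP: tu; rewrite tm ms eq_iter_perm !modn_small //.
by move/eqP.
Qed.

Lemma joint_orbit_min (U : {set 'I_n}) :
  stable_set x U -> gcycle g a \subset U -> joint_orbit x g a \subset U.
Proof.
move=> xU aU; apply/subsetP => y; rewrite inE => /existsP[e /andP[ae /(stable_fconnect xU) ->]].
by apply: (subsetP aU); rewrite inE.
Qed.

Lemma stable_joint_orbit : stable_set x (joint_orbit x g a).
Proof.
move=> y; rewrite !inE => /existsP[e /andP[ae ey]]; apply/existsP; exists e.
by rewrite ae -same_fconnect1_r //; apply: perm_inj.
Qed.

Lemma gcycle_joint_orbit : gcycle g a \subset joint_orbit x g a.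
Proof.
by apply/subsetP => y; rewrite !inE => ay; apply/existsP; exists y; rewrite ay connect0.
Qed.

End Return.

Lemma perm_on_stable n (x : 'S_n) A : perm_on A x -> stable_set x A.
Proof. by move=> xA y; rewrite (perm_closed _ xA). Qed.

(** Orders and shifts inside U only involve the values on U. Roots agree as well, since [froot] is
    the [pick] of an orbit and equal orbits have the same [pick]. *)
Lemma eq_even_weight zeta n (g x y : 'S_n) (U : {set 'I_n}) :
  stable_set x U -> stable_set g U -> {in U, x =1 y} ->
  even_weight zeta x g U = even_weight zeta y g U.
Proof.
move=> xU gU eq_xy.
have eq_it r j : r \in U -> iter j x r = iter j y r.
  by move=> rU; elim: j => //= j <-; rewrite eq_xy // mem_iter.
have eq_conn r : r \in U -> fconnect x r =1 fconnect y r.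
  move=> rU z; apply/fconnect_iterP/fconnect_iterP => -[j ->]; exists j.
    exact: eq_it.
  by rewrite eq_it.
have eq_root r : r \in U -> froot x r = froot y r.
  by move=> rU; congr odflt; apply: eq_pick; apply: eq_conn.
have eq_ord r : r \in U -> ord x r = ord y r.
  by move=> rU; apply: eq_card => z; apply: eq_conn.
have eq_orbit r : r \in U -> fingraph.orbit x r = fingraph.orbit y r.
  move=> rU; rewrite /fingraph.orbit -eq_ord //; apply: (@eq_from_nth _ r).
    by rewrite !size_traject.
  by move=> i; rewrite size_traject => io; rewrite !nth_traject // eq_it.
rewrite /even_weight (eq_bigl (fun r => (r \in U) && froots y r)); last first.
  by move=> r; case: (boolP (r \in U)) => //= rU; rewrite /roots /= eq_root.
apply: eq_bigr => r /andP[rU _]; rewrite /root_weight eq_ord //; congr (_ * _ ^+ _).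
have grU : g r \in U by apply: gU.
rewrite /cshift /findex -eq_root // eq_orbit //.
rewrite -(stable_fconnect xU (froot_connect x (g r))) //.
Qed.

Lemma even_weightU zeta n (g x : 'S_n) (U V : {set 'I_n}) : U \subset V ->
  even_weight zeta x g V = even_weight zeta x g U * even_weight zeta x g (V :\: U).
Proof.
move=> UV; rewrite /even_weight (bigID (mem U)) /=; congr (_ * _); apply: eq_bigl => r.
  rewrite andbC; case: (boolP (r \in U)) => //= rU.
  by rewrite (subsetP UV).
by rewrite inE andbC andbA.
Qed.

(** * Bypassing a cycle *)

Section ReturnStep.
Variables (n : nat) (g x : 'S_n) (A : {set 'I_n}) (a c : 'I_n).
Hypotheses (gA : stable_set g A) (aA : a \in A) (cA : c \in A).
Hypothesis eq_ord : ord g c = ord g a.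
Hypothesis xP : x \in centralizer_on g (A :\: gcycle g c).
Let t := cycle_transfer g a c.
Let y := (t * x)%g.
Let xg : x \in 'C[g]%g.
Proof. by move: xP; rewrite centralizer_onE cent1C => /andP[]. Qed.
Let x_on : perm_on (A :\: gcycle g c) x.
Proof. by move: xP; rewrite centralizer_onE => /andP[]. Qed.
Let ta : t a = c. Proof. by case: (transferP eq_ord). Qed.
Let tg : t \in 'C[g]%g. Proof. by case: (transferP eq_ord); rewrite cent1C. Qed.
Let t_out z : ~~ fconnect g a z -> ~~ fconnect g c z -> t z = z.
Proof.
case: (transferP eq_ord) => _ t_on _ _ az cz.
by apply: (out_perm t_on); rewrite !inE negb_or az.
Qed.
Let x_fix z : fconnect g c z -> x z = z.
Proof. by move=> cz; apply: (out_perm x_on); rewrite !inE cz. Qed.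
Let yE z : y z = x (t z). Proof. by rewrite permM. Qed.
Let ya : y a = c. Proof. by rewrite yE ta x_fix ?connect0. Qed.
Let t_iter j : t (iter j g a) = iter j g c.
Proof. by rewrite cent_iter ?ta. Qed.
Let y_iter j : y (iter j g a) = iter j g c.
Proof. by rewrite yE t_iter x_fix ?fconnect_iter. Qed.

Section SameCycle.
Hypothesis ac : fconnect g a c.

Lemma is_return_same : is_return g y a 1 (findex g a c).
Proof.
split=> //; [exact: findex_max | by rewrite /= ya iter_findex |].
by move=> k; rewrite ltnS => /andP[k_gt0]; rewrite leqNgt k_gt0.
Qed.

Lemma joint_orbit_same : joint_orbit y g a = gcycle g a.
Proof.
apply/eqP; rewrite eqEsubset gcycle_joint_orbit andbT; apply: joint_orbit_min => //.
move=> z; rewrite !inE => /fconnect_iterP[j ->]; rewrite y_iter.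
exact: connect_trans ac (fconnect_iter _ _ _).
Qed.

Lemma even_weight_same zeta :
  even_weight zeta y g (A :\: joint_orbit y g a) = even_weight zeta x g (A :\: gcycle g c).
Proof.
have eq_cyc : gcycle g c = gcycle g a.
  by apply/setP => z; rewrite !inE (same_connect (@perm_fconnect_sym _ g) ac).
rewrite joint_orbit_same -eq_cyc; apply/esym; apply: eq_even_weight.
- exact: perm_on_stable.
- by apply: stableD => //; apply: stable_gcycle.
move=> z; rewrite !inE => /andP[cz zA]; rewrite yE t_out //.
by rewrite (same_connect (@perm_fconnect_sym _ g) ac).
Qed.

End SameCycle.

Section OtherCycle.
Hypothesis nac : ~~ fconnect g a c.
Let tc : t c = a. Proof. by case: (transferP eq_ord) => _ _ _; apply. Qed.
Let tc_iter j : t (iter j g c) = iter j g a.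
Proof. by rewrite cent_iter ?tc. Qed.
Let yc_iter j : y (iter j g c) = iter j g (x a).
Proof. by rewrite yE tc_iter cent_iter. Qed.
Let y_out z : ~~ fconnect g a z -> ~~ fconnect g c z -> y z = x z.
Proof. by move=> az cz; rewrite yE t_out. Qed.

Let x_iter_out k : ~~ fconnect g c (iter k x a).
Proof.
elim: k => [|k IHk]; first by rewrite /= perm_fconnect_sym.
rewrite iterS; apply: contra IHk => ck.
by have /perm_inj <- := x_fix ck.
Qed.

(** Since [y] sends [a] to [c] and [c] to [x a], its path from [a] is that of [x] with one extra
    stop at [c], until [x] returns to the [g]-cycle of [a]. The path of [x] avoids the cycle of [c],
    which [x] fixes. *)
Let y_iter_step m : (forall k, (0 < k < m)%N -> ~~ fconnect g a (iter k x a)) ->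
  (0 < m)%N -> iter m.+1 y a = iter m x a.
Proof.
elim: m => // m IHm first_m _; have [m0|m_gt0] := posnP m.
  by rewrite m0 /= ya (yc_iter 0).
rewrite iterS IHm // => [|k /andP[k_gt0 km]]; last by rewrite first_m // k_gt0 ltnW.
by rewrite y_out // first_m // m_gt0 /=.
Qed.

Lemma is_return_other m s : is_return g x a m s -> is_return g y a m.+1 s.
Proof.
case=> m_gt0 s_lt ms first_m; split=> //; first by rewrite y_iter_step.
case=> // -[|k] km; first by rewrite /= ya.
rewrite y_iter_step //; first by rewrite first_m.
by move=> j /andP[j_gt0 jk]; rewrite first_m // j_gt0 (ltn_trans jk).
Qed.

(** [y] carries the cycle of [a] to that of [c], the latter to the image under [x] of the cycle of
    [a], and is [x] elsewhere. The inclusions follow from the minimality of joint orbits. *)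
Lemma joint_orbit_other : joint_orbit y g a = joint_orbit x g a :|: gcycle g c.
Proof.
have Oa := subsetP (gcycle_joint_orbit g y a); have Oy := @stable_joint_orbit _ g y a.
have Oxa := subsetP (gcycle_joint_orbit g x a); have Ox := @stable_joint_orbit _ g x a.
have Oc : gcycle g c \subset joint_orbit y g a.
  apply/subsetP => z; rewrite inE => /fconnect_iterP[j ->]; rewrite -y_iter.
  by apply: Oy; apply: Oa; rewrite inE fconnect_iter.
apply/eqP; rewrite eqEsubset subUset Oc andbT; apply/andP; split; apply: joint_orbit_min.
- move=> z; have [/fconnect_iterP[j ->] _|az] := boolP (fconnect g a z).
    by rewrite y_iter !inE fconnect_iter orbT.
  have [/fconnect_iterP[j ->] _|cz] := boolP (fconnect g c z).
    rewrite yc_iter inE -cent_iter //; apply/orP; left.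
    by apply: Ox; apply: Oxa; rewrite inE fconnect_iter.
  rewrite y_out // in_setU [_ \in gcycle g c]inE (negPf cz) orbF => /Ox Oxz.
  by rewrite in_setU Oxz.
- by apply: subset_trans (subsetUl _ _); apply: gcycle_joint_orbit.
- move=> z Oz; have [/fconnect_iterP[j ->]|az] := boolP (fconnect g a z).
    rewrite cent_iter // -yc_iter; apply: Oy; apply: (subsetP Oc).
    by rewrite inE fconnect_iter.
  have [cz|cz] := boolP (fconnect g c z); first by rewrite x_fix.
  by rewrite -y_out //; apply: Oy.
- exact: gcycle_joint_orbit.
Qed.

Lemma even_weight_other zeta :
  even_weight zeta y g (A :\: joint_orbit y g a) =
  even_weight zeta x g (A :\: gcycle g c :\: joint_orbit x g a).
Proof.
have g_O : stable_set g (joint_orbit x g a).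
  move=> z; rewrite !inE => /existsP[e /andP[ae ez]]; apply/existsP; exists (g e).
  rewrite -same_fconnect1_r ?ae; last exact: perm_inj.
  by rewrite (@fconnect_iter_comm _ x g _ 1) // cent1C.
rewrite joint_orbit_other setUC -setDDl; apply/esym; apply: eq_even_weight.
- apply: stableD; first exact: perm_on_stable.
  exact: stable_joint_orbit.
- by apply: stableD => //; apply: stableD => //; apply: stable_gcycle.
move=> z; rewrite inE => /andP[zO]; rewrite !inE => /andP[cz _]; rewrite y_out //.
by apply: contra zO => az; apply: (subsetP (gcycle_joint_orbit g x a)); rewrite inE.
Qed.

End OtherCycle.
End ReturnStep.

(** Points are counted instead of cycles, hence the factor l; the value [b 0] is left free. *)
Definition has_cycle_counts n (g : 'S_n) (A : {set 'I_n}) (b : nat -> nat) :=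
  forall l, (0 < l)%N -> #|[set y in A | ord g y == l]| = (b l * l)%N.

Section CycleCounts.
Variables (n : nat) (g : 'S_n) (A : {set 'I_n}) (b : nat -> nat).
Hypotheses (gA : stable_set g A) (Ab : has_cycle_counts g A b).

Lemma card_gcycle a : #|gcycle g a| = ord g a.
Proof. by rewrite /gcycle cardsE. Qed.

Lemma card_ordD c l : c \in A ->
  #|[set y in A | ord g y == l]| =
  (#|[set y in A :\: gcycle g c | ord g y == l]| + (l == ord g c) * l)%N.
Proof.
move=> cA; rewrite -(cardsID (gcycle g c)) addnC; congr (_ + _)%N.
  by apply: eq_card => y; rewrite !inE andbA.
have [->|lc] := eqVneq l (ord g c).
  rewrite mul1n -[RHS]card_gcycle; apply: eq_card => y; rewrite !inE.
  apply/andP/idP => [[] //|cy]; split=> //.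
  by rewrite (stable_fconnect gA cy) cA (order_fconnect cy) eqxx.
rewrite mul0n; apply: eq_card0 => y; rewrite !inE.
apply/negP => /andP[/andP[_ /eqP yl] cy]; case/eqP: lc.
by rewrite -yl (order_fconnect cy).
Qed.

Lemma has_cycle_countsD c : c \in A ->
  has_cycle_counts g (A :\: gcycle g c) (fun l => b l - (l == ord g c))%N.
Proof.
move=> cA l l_gt0; have := card_ordD l cA; rewrite Ab // mulnBl => ->.
by rewrite addnK.
Qed.

Lemma cycle_counts_gt0 c : c \in A -> (0 < b (ord g c))%N.
Proof.
move=> cA; have o_gt0 := fingraph.order_gt0 g c.
have := card_ordD (ord g c) cA; rewrite Ab // eqxx mul1n.
by case: (b _) => //; lia.
Qed.

Lemma card_other_cycles a : a \in A ->
  #|[set c in A | (ord g c == ord g a) && ~~ fconnect g a c]| =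
  ((b (ord g a)).-1 * ord g a)%N.
Proof.
move=> aA; have := has_cycle_countsD aA (fingraph.order_gt0 g a).
rewrite eqxx subn1 => <-; apply: eq_card => c; rewrite !inE.
by rewrite andbA [RHS]andbC [RHS]andbCA [_ && (c \in A)]andbC andbC.
Qed.

End CycleCounts.

Lemma sum_gcycle n (g : 'S_n) a (F : nat -> algC) :
  \sum_(c | fconnect g a c) F (findex g a c) = \sum_(s < ord g a) F s.
Proof.
transitivity (\sum_(c in [set iter (val s) g a | s in 'I_(ord g a)]) F (findex g a c)).
  apply: eq_bigl => c; apply/idP/imsetP => [ac|[s _ ->]]; last exact: fconnect_iter.
  by exists (Ordinal (findex_max ac)); rewrite //= iter_findex.
rewrite big_imset //=; last first.
  move=> s s' _ _ /eqP; rewrite eq_iter_perm !modn_small ?ltn_ord //.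
  by move/eqP/val_inj.
by apply: eq_big => // s _; rewrite findex_iter.
Qed.

(** * The sum of even weights as a product over cycle lengths *)

Section EvenSum.
Variables (zeta : nat -> algC) (zetaP : prim_root_family zeta).
Variables (n : nat) (g : 'S_n).
Implicit Types (A : {set 'I_n}) (b : nat -> nat) (phi : nat -> nat -> algC).

Definition even_sum A : algC := \sum_(x in centralizer_on g A) even_weight zeta x g A.

(** With [phi] arbitrary, bypassing a cycle stays within this family of sums: [phi m s] becomes
    [phi m.+1 s]. Taking [orbit_weight] for [phi] gives back [even_sum]. *)
Definition marked_sum phi A a : algC :=
  \sum_(x in centralizer_on g A) phi (return_time g x a) (return_shift g x a) *
     even_weight zeta x g (A :\: joint_orbit x g a).

Definition count_prod b : algC := \prod_(1 <= l < n.+1) even_count l (b l).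
Definition count_prod' b l0 : algC := \prod_(1 <= l < n.+1 | l != l0) even_count l (b l).

Lemma count_prodD1 b l0 : (0 < l0 <= n)%N ->
  count_prod b = even_count l0 (b l0) * count_prod' b l0.
Proof.
by move=> l0n; rewrite /count_prod (bigD1_seq l0) ?iota_uniq // mem_index_iota ltnS.
Qed.

Lemma ord_le (a : 'I_n) : (0 < ord g a <= n)%N.
Proof.
by rewrite fingraph.order_gt0 -[X in (_ <= X)%N]card_ord max_card.
Qed.

(** Split by c = x a. On the cycle of [a] the orbit closes with m = 1 and leaves an [even_sum] over
    a smaller set, whose value is a hypothesis because [even_sumE] uses this lemma in its own
    induction. On another cycle of the same length, that cycle is bypassed and the inner induction
    applies with the shifted [phi]; the result is the same for all such c, of which there are (b -
    1) l. *)
Lemma marked_sumE (N : nat) :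
  (forall A b, (#|A| < N)%N -> stable_set g A -> has_cycle_counts g A b ->
     even_sum A = count_prod b) ->
  forall A b a phi, (#|A| <= N)%N -> stable_set g A -> has_cycle_counts g A b -> a \in A ->
  marked_sum phi A a =
    first_orbit_sum (ord g a) (b (ord g a)) (fun m => \sum_(s < ord g a) phi m s) *
    count_prod' b (ord g a).
Proof.
move=> IH A; have [k] := ubnP #|A|; elim: k A => // k IHk A ltAk b a phi leAN gA Ab aA.
set l := ord g a; have b_gt0 := cycle_counts_gt0 gA Ab aA.
have ltA c : c \in A -> (#|A :\: gcycle g c| < #|A|)%N.
  move=> cA; apply: proper_card; apply/properP; split; first exact: subsetDl.
  by exists c; rewrite // !inE connect0.
have gAc c : stable_set g (A :\: gcycle g c) by apply: stableD => //; apply: stable_gcycle.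
rewrite /marked_sum (sum_centralizer_on _ gA aA).
rewrite (bigID (fconnect g a)) /=.
have rest' c : ord g c = l ->
    count_prod' (fun l' => b l' - (l' == ord g c))%N l = count_prod' b l.
  by move=> cl; apply: eq_bigr => l' l'l; rewrite cl (negPf l'l) subn0.
have -> : first_orbit_sum l (b l) (fun m => \sum_(s < l) phi m s) =
   (\sum_(s < l) phi 1%N s) * even_count l (b l).-1 +
   ((b l).-1 * l)%:R * first_orbit_sum l (b l).-1 (fun m => \sum_(s < l) phi m.+1 s).
  by rewrite -{1}(prednK b_gt0).
rewrite mulrDl; congr (_ + _).
  rewrite -mulrA -sum_gcycle mulr_suml.
  apply: eq_big => [c|c /andP[/andP[cA /eqP cl] ac]].
    apply/andP/idP => [[] //|ac]; split=> //.
    by rewrite (stable_fconnect gA ac) aA (order_fconnect ac) eqxx.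
  have -> : even_count l (b l).-1 * count_prod' b l = even_sum (A :\: gcycle g c).
    rewrite (IH _ (fun l' => b l' - (l' == ord g c))%N) //; last exact: has_cycle_countsD.
      rewrite (@count_prodD1 _ l) ?ord_le // rest' //.
      by rewrite cl eqxx subn1.
    exact: leq_trans (ltA c cA) leAN.
  rewrite /even_sum mulr_sumr; apply: eq_bigr => x xP.
  by case: (return_unique (is_return_same cl xP ac)) => -> ->; rewrite even_weight_same.
rewrite (eq_bigl (fun c => c \in [set c in A | (ord g c == l) && ~~ fconnect g a c])); last first.
  by move=> c; rewrite inE andbA.
rewrite -mulrA -(card_other_cycles gA Ab aA) mulr_natl -sumr_const.
apply: eq_bigr => c; rewrite inE => /and3P[cA /eqP cl nac].
have aAc : a \in A :\: gcycle g c by rewrite !inE perm_fconnect_sym nac.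
have := IHk (A :\: gcycle g c) _ _ a (fun m => phi m.+1) _ (gAc c) (has_cycle_countsD gA Ab cA) aAc.
rewrite (leq_trans (ltA c cA)) // (leq_trans _ leAN) ?(ltnW (ltA c cA)) // => /(_ isT isT).
rewrite rest' // cl eqxx subn1 => <-.
apply: eq_bigr => x xP; have ret := returnP g x a.
have [-> ->] := return_unique (is_return_other cl xP nac ret).
by rewrite even_weight_other.
Qed.

Lemma even_sumE A b : stable_set g A -> has_cycle_counts g A b -> even_sum A = count_prod b.
Proof.
have [N] := ubnP #|A|; elim: N A b => // N IH A b ltAN gA Ab.
have [A0|[a aA]] := set_0Vmem A.
  have b0 l : (0 < l)%N -> b l = 0%N.
    move=> l_gt0; have := Ab l l_gt0; rewrite A0 eq_card0 => [|y]; last by rewrite !inE.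
    by case: (b l) => // k; lia.
  rewrite /count_prod big_nat big1 => [|l /andP[l_gt0 _]]; last by rewrite b0.
  rewrite /even_sum (big_pred1 1%g) => [|x].
    by rewrite /even_weight A0 big_pred0 // => r; rewrite inE.
  rewrite centralizer_onE A0; apply/andP/eqP => [[_ x1]|->].
    by apply/permP => y; rewrite perm1 (out_perm x1) ?inE.
  by rewrite perm_on1; split=> //; apply/cent1P; rewrite /commute mul1g mulg1.
have b_gt0 := cycle_counts_gt0 gA Ab aA.
(* Only sums over s at fixed m appear on the right, so the roots of unity enter through [shift_sum]
   alone. *)
have := marked_sumE IH (orbit_weight zeta ^~ (ord g a)) ltAN gA Ab aA.
rewrite (@eq_first_orbit_sum _ _ _ (shift_sum (ord g a))) => [|m m_gt0]; last first.
  by rewrite sum_orbit_weight // fingraph.order_gt0.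
rewrite -(prednK b_gt0) first_orbit_sum_shift prednK // -count_prodD1 ?ord_le // => <-.
apply: eq_bigr => x; rewrite centralizer_onE => /andP[xg xA].
have [m_gt0 s_lt ret first_ret] := returnP g x a.
have Osub : joint_orbit x g a \subset A.
  by apply: joint_orbit_min; [exact: perm_on_stable | exact: gcycle_sub].
rewrite (even_weightU _ _ _ Osub); congr (_ * _).
exact: even_weight_joint_orbit.
Qed.

End EvenSum.

(** * Higher Lie characters as sums over centralizers *)

Section Sections.
Variables (zeta : nat -> algC) (zetaP : prim_root_family zeta) (n : nat).
Variables (x z : 'S_n) (rho : 'I_n -> 'I_n).
Hypothesis zx : z \in 'C[x]%g.
Hypothesis rho_conn : forall y, fconnect x y (rho y).
Hypothesis rho_eq : forall y y', fconnect x y y' -> rho y = rho y'.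

Let E y := findex x (rho y) (froot x y).
Let R y := findex x (rho y) y.

Let conn_rho y : fconnect x (rho y) y.
Proof. by rewrite perm_fconnect_sym. Qed.

Let iter_R y : iter (R y) x (rho y) = y.
Proof. exact: iter_findex. Qed.

Let iter_E y : iter (E y) x (rho y) = froot x y.
Proof. by apply: iter_findex; apply: connect_trans (conn_rho y) (connect_root _ _). Qed.

Let z_conn y y' : fconnect x (z y) (z y') = fconnect x y y'.
Proof.
apply/fconnect_iterP/fconnect_iterP => -[j e]; exists j; last by rewrite e cent_iter.
by apply: (@perm_inj _ z); rewrite cent_iter.
Qed.

Let ord_rho y : ord x (rho y) = ord x y.
Proof. exact: order_fconnect. Qed.

Let shift_eq r : froots x r ->
  (E r + R (z (rho r)) = E (z r) + cshift x z r %[mod ord x r])%N.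
Proof.
move=> /eqP rr; set u := rho (z r).
have zrho : rho (z (rho r)) = u.
  by apply: rho_eq; rewrite z_conn.
have ord_u : ord x u = ord x r by rewrite ord_rho order_cent.
apply/eqP; rewrite -ord_u -eq_iter_perm; apply/eqP.
rewrite iterD -zrho iter_R zrho [in RHS]addnC iterD /u iter_E froot_cshift.
by rewrite -cent_iter // iter_E rr.
Qed.

Let prod_E : \prod_(r | froots x r) zeta (ord x r) ^+ E r =
  \prod_(r | froots x r) zeta (ord x r) ^+ E (z r).
Proof.
rewrite (reindex_onto (fun r => froot x (z r)) (fun r => froot x ((z^-1)%g r))) /=; last first.
  move=> r /eqP rr; rewrite -[RHS]rr; apply/eqP; rewrite froot_fconnect.
  by rewrite -[X in fconnect _ _ X](permKV z) z_conn froot_connect.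
apply: eq_big => r.
  rewrite froots_froot /=; apply/idP/idP => [/eqP <-|rr]; first exact: froots_froot.
  rewrite -[X in _ == X](eqP rr) froot_fconnect.
  by rewrite -z_conn permKV froot_connect.
move=> _; rewrite order_froot order_cent //; congr (_ ^+ _).
have conn : fconnect x (froot x (z r)) (z r) by apply: froot_connect.
by rewrite /E (rho_eq conn) -/(froot x _) (eqP (froots_froot _ _)).
Qed.

(** [omega_val] does not depend on the representatives of the cycles. Passing from [froot] to [rho]
    changes the shift at r by E (z r) - E r, where E is the offset between the two representatives;
    as z permutes the cycles, these changes cancel in the product. *)
Lemma omega_val_section : omega_val zeta x z =
  \prod_(r | rho r == r) zeta (ord x r) ^+ findex x (rho (z r)) (z r).
Proof.
have z0 r k : zeta (ord x r) ^+ k != 0.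
  have o_gt0 : (0 < ord x r)%N by apply: fingraph.order_gt0.
  by rewrite expf_neq0 // (prim_root_eq0 (zetaP o_gt0)) -lt0n.
transitivity (\prod_(r | froots x r) zeta (ord x r) ^+ R (z (rho r))).
  have nz : \prod_(r | froots x r) zeta (ord x r) ^+ E (z r) != 0.
    by apply/prodf_neq0 => r _.
  apply: (mulfI nz); rewrite -[in RHS]prod_E /omega_val -!big_split /=.
  apply: eq_bigr => r rr; rewrite -!exprD; apply/eqP.
  have o_gt0 : (0 < ord x r)%N by apply: fingraph.order_gt0.
  by rewrite (eq_prim_root_expr (zetaP o_gt0)) shift_eq.
have froot_rho r : froots x r -> froot x (rho r) = r.
  by move=> /eqP rr; rewrite -[RHS]rr; apply/eqP; rewrite froot_fconnect.
have rho_rho r : rho (rho r) = rho r by apply: rho_eq.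
have rho_froot r : rho (froot x r) = rho r.
  by apply: rho_eq; apply: froot_connect.
rewrite [RHS](reindex_onto rho (froot x)) /=; last first.
  by move=> r /eqP rr; rewrite rho_froot.
apply: eq_big => r; last by rewrite ord_rho.
rewrite rho_rho eqxx /=; apply/idP/eqP => [/froot_rho // | <-].
exact: froots_froot.
Qed.

End Sections.

Lemma iter_conj n (x h : 'S_n) j y : iter j (x ^ h)%g (h y) = h (iter j x y).
Proof. by elim: j => //= j ->; rewrite permJ. Qed.

Lemma fconnect_conj n (x h : 'S_n) y y' :
  fconnect (x ^ h)%g (h y) (h y') = fconnect x y y'.
Proof.
apply/fconnect_iterP/fconnect_iterP => -[j e]; exists j; last by rewrite e iter_conj.
by apply: (@perm_inj _ h); rewrite e iter_conj.
Qed.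

Lemma order_conj n (x h : 'S_n) y : ord (x ^ h)%g (h y) = ord x y.
Proof.
apply: order_eqP => j; rewrite iter_conj (inj_eq perm_inj).
exact: iter_perm_id.
Qed.

Lemma findex_conj n (x h : 'S_n) y y' : fconnect x y y' ->
  findex (x ^ h)%g (h y) (h y') = findex x y y'.
Proof.
move=> yy'; rewrite -{1}(iter_findex yy') -iter_conj findex_iter //.
by rewrite order_conj findex_max.
Qed.

(** Conjugation by h need not send roots of x to roots of [x ^ h], but the roots of [x ^ h] pulled
    back by h form another system of representatives for x. *)
Lemma omega_valJ zeta (zetaP : prim_root_family zeta) n (x z h : 'S_n) :
  z \in 'C[x]%g -> omega_val zeta (x ^ h)%g (z ^ h)%g = omega_val zeta x z.
Proof.
move=> zx; pose rho y := (h^-1)%g (froot (x ^ h)%g (h y)).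
have hrho y : h (rho y) = froot (x ^ h)%g (h y) by rewrite permKV.
have conn y : fconnect x y (rho y).
  by rewrite -(fconnect_conj x h) hrho connect_root.
rewrite (omega_val_section zetaP zx conn) => [|y y' yy']; last first.
  by apply: (@perm_inj _ h); rewrite !hrho; apply/eqP; rewrite froot_fconnect fconnect_conj.
rewrite /omega_val (reindex_inj (@perm_inj _ h)) /=; apply: eq_big => r.
  by rewrite -(inj_eq (@perm_inj _ h)) hrho.
move=> _; rewrite order_conj /cshift permJ -hrho findex_conj //.
by rewrite perm_fconnect_sym.
Qed.

(** * Cycle types and conjugacy classes *)

Definition cycle_lengths n (x : 'S_n) : seq nat :=
  [seq #|pred_of_set c| | c <- enum (porbits x)].

Section CycleLengths.
Variables (n : nat) (x : 'S_n).

Lemma porbit_gcycle y : porbit x y = gcycle x y.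
Proof.
apply/setP => z; rewrite inE; apply/porbitP/fconnect_iterP => -[j ->]; exists j.
  by rewrite permX.
by rewrite permX.
Qed.

Lemma sum_cycle_lengths (F : nat -> nat) :
  (\sum_(y : 'I_n) F (ord x y) = \sum_(l <- cycle_lengths x) l * F l)%N.
Proof.
rewrite (partition_big (porbit x) (mem (porbits x))) => [|y _] /=; last first.
  exact: imset_f.
rewrite big_map big_enum /=; apply: eq_bigr => c /imsetP[y _ ->].
rewrite -sum_nat_const; apply: eq_big => z; last first.
  by move=> /eqP <-; rewrite porbit_gcycle card_gcycle.
by rewrite -[z \in _]/(z \in porbit x y) -eq_porbit_mem eq_sym.
Qed.

Lemma count_cycle_lengths l :
  #|[set y | ord x y == l]| = (count_mem l (cycle_lengths x) * l)%N.
Proof.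
rewrite -sum1dep_card big_mkcond /= (sum_cycle_lengths (fun k => if k == l then 1 else 0)%N).
elim: (cycle_lengths x) => [|k s IHs]; first by rewrite big_nil.
rewrite big_cons IHs /= mulnDl; congr (_ + _)%N.
by case: eqP => [->|_]; rewrite ?mul1n ?muln1 ?mul0n ?muln0.
Qed.

Lemma sumn_cycle_lengths : sumn (cycle_lengths x) = n.
Proof.
have := sum_cycle_lengths (fun=> 1%N); rewrite sum1_card card_ord => {2}->.
by rewrite sumnE; apply: eq_bigr => l _; rewrite muln1.
Qed.

Lemma cycle_lengths_gt0 : 0%N \notin cycle_lengths x.
Proof.
apply/mapP => -[c]; rewrite mem_enum => /imsetP[y _ ->].
by rewrite porbit_gcycle card_gcycle => /esym/eqP; rewrite eqn0Ngt fingraph.order_gt0.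
Qed.

Lemma all_cycle_lengths (p : pred nat) :
  all p (cycle_lengths x) = [forall y, p (ord x y)].
Proof.
apply/allP/forallP => [px y|px l /mapP[c]].
  apply: px; apply/mapP; exists (porbit x y); first by rewrite mem_enum imset_f.
  by rewrite porbit_gcycle card_gcycle.
by rewrite mem_enum => /imsetP[y _ ->] ->; rewrite porbit_gcycle card_gcycle.
Qed.

End CycleLengths.

Lemma has_cycle_typeP n (x : 'S_n) (la : seq nat) : 0%N \notin la ->
  has_cycle_type x la <->
  (forall l, (0 < l)%N -> #|[set y | ord x y == l]| = (nparts l la * l)%N).
Proof.
move=> la0; rewrite /has_cycle_type -/(cycle_lengths x).
split=> [/seq.permP xla l _|xla]; first by rewrite count_cycle_lengths xla.
apply/allP => l _ /=; have [->|l_gt0] := posnP l.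
  by rewrite !(count_memPn _) // cycle_lengths_gt0.
by rewrite -(eqn_pmul2r l_gt0) -count_cycle_lengths xla.
Qed.

Lemma intpart_gt0 n (la : intpart n) : 0%N \notin (la : seq nat).
Proof. by case: la => s /= /and3P[]. Qed.

Section Conjugation.
Variables (n : nat) (x y : 'S_n).
Hypothesis eq_counts : forall l, (0 < l)%N ->
  #|[set r | ord x r == l]| = #|[set r | ord y r == l]|.

Let roots_of (u : 'S_n) l := enum [predI froots u & order_set u l].

Let mem_roots u l r : (r \in roots_of u l) = froots u r && (ord u r == l).
Proof. by rewrite mem_enum. Qed.

Let card_roots u l : (size (roots_of u l) * l)%N = #|[set r | ord u r == l]|.
Proof.
have := @fcard_order_set _ u (@perm_inj _ u) l (order_set u l).
rewrite /roots_of -cardE cardsE => -> //.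
apply: intro_closed; first exact: perm_fconnect_sym.
move=> r r' /eqP <-; rewrite !inE => /eqP rl. 
by rewrite (order_fconnect (fconnect1 u r)) rl.
Qed.

Let size_roots l : (0 < l)%N -> size (roots_of x l) = size (roots_of y l).
Proof.
by move=> l_gt0; apply/eqP; rewrite -(eqn_pmul2r l_gt0) !card_roots eq_counts.
Qed.

(** The k-th root of x of a given order goes to the k-th root of y of that order; the conjugating
    permutation extends this matching along the cycles. *)
Let match_root r := nth r (roots_of y (ord x r)) (index r (roots_of x (ord x r))).

Let match_rootP r : froots x r ->
  [/\ froots y (match_root r), ord y (match_root r) = ord x r &
      (index r (roots_of x (ord x r)) < size (roots_of y (ord x r)))%N].
Proof.
move=> rr; have idx : (index r (roots_of x (ord x r)) < size (roots_of y (ord x r)))%N.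
  by rewrite -size_roots ?fingraph.order_gt0 // index_mem mem_roots rr eqxx.
have : match_root r \in roots_of y (ord x r) by apply: mem_nth.
by rewrite mem_roots => /andP[yr /eqP].
Qed.

Let match_root_inj r r' : froots x r -> froots x r' -> match_root r = match_root r' -> r = r'.
Proof.
move=> rr rr' eq_rr'; have [_ o i] := match_rootP rr; have [_ o' i'] := match_rootP rr'.
have oo : ord x r = ord x r' by rewrite -o eq_rr' o'.
move/eqP: eq_rr'; rewrite /match_root oo (set_nth_default r') -?oo //.
rewrite nth_uniq ?enum_uniq -?oo ?i //; last by rewrite oo.
move=> /eqP idx; have m : r \in roots_of x (ord x r') by rewrite mem_roots rr oo eqxx.
have m' : r' \in roots_of x (ord x r') by rewrite mem_roots rr' eqxx.
by rewrite oo in idx; rewrite -[LHS](nth_index r m) idx nth_index.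
Qed.

Let conj_fun z := iter (findex x (froot x z) z) y (match_root (froot x z)).

Let conj_fun_iter r j : froots x r -> conj_fun (iter j x r) = iter j y (match_root r).
Proof.
move=> rr; rewrite /conj_fun froot_iter (eqP rr); apply/eqP.
have [_ o _] := match_rootP rr; rewrite eq_iter_perm o -eq_iter_perm.
by rewrite iter_findex ?fconnect_iter.
Qed.

Let zE z : z = iter (findex x (froot x z) z) x (froot x z).
Proof. by rewrite iter_findex ?froot_connect. Qed.

Let conj_fun_inj : injective conj_fun.
Proof.
move=> z z'; rewrite (zE z) (zE z') !conj_fun_iter ?froots_froot // => eq_it.
have [ry o _] := match_rootP (froots_froot x z).
have [ry' o' _] := match_rootP (froots_froot x z').
have rr : froot x z = froot x z'.
  apply: match_root_inj; rewrite ?froots_froot //.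
  by rewrite -(eqP ry) -(eqP ry') -(froot_iter y (findex x (froot x z) z)) eq_it froot_iter.
rewrite -rr in eq_it *; apply/eqP.
by rewrite eq_iter_perm -o -eq_iter_perm eq_it.
Qed.

Lemma eq_counts_conj : exists h, (x ^ h)%g = y.
Proof.
exists (perm conj_fun_inj); apply/permP => w.
rewrite -(permKV (perm conj_fun_inj) w); set z := ((perm _)^-1)%g w.
rewrite permJ !permE {1 2}(zE z) -iterS !conj_fun_iter ?froots_froot //.
Qed.

End Conjugation.

Lemma has_cycle_type_class n (la : intpart n) (x : 'S_n) :
  (x \in (perm_of_type la ^: [set: 'S_n])%g) = has_cycle_type x la.
Proof.
have la0 := intpart_gt0 la; have laP := perm_of_typeP la.
apply/imsetP/idP => [[h _ ->]|xla].
  apply/has_cycle_typeP => // l l_gt0; move/has_cycle_typeP: laP => <- //.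
  rewrite -[RHS](card_imset _ (@perm_inj _ h)); apply: eq_card => y; rewrite [LHS]inE.
  apply/idP/imsetP => [yl|[z]]; last by rewrite inE => zl ->; rewrite order_conj.
  exists ((h^-1)%g y); last by rewrite permKV.
  by rewrite inE -(order_conj _ h) permKV.
have [h hE] : exists h, ((perm_of_type la) ^ h)%g = x.
  apply: eq_counts_conj => l l_gt0.
  move/has_cycle_typeP: laP => -> //; move/has_cycle_typeP: xla => -> //.
by exists h; rewrite ?inE.
Qed.

Lemma sum_conjugates n (x : 'S_n) (f : 'S_n -> algC) :
  \sum_(h : 'S_n) f (x ^ h)%g =
  #|'C[x]%g|%:R * \sum_(y in (x ^: [set: 'S_n])%g) f y.
Proof.
rewrite (partition_big (fun h => (x ^ h)%g) (mem (x ^: [set: 'S_n])%g)) => [|h _]; last first.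
  exact: imset_f.
rewrite mulr_sumr; apply: eq_bigr => y /imsetP[k _ ->] /=.
rewrite (eq_bigr (fun=> f (x ^ k)%g)) => [|h /eqP -> //].
rewrite (eq_bigl (fun h => h \in ('C[x] :* k)%g)) => [|h]; last first.
  rewrite mem_rcoset cent1C; apply/eqP/cent1P => [xhk|xhk].
    by apply/commgP/conjg_fixP; rewrite conjgM xhk -conjgM mulgV conjg1.
  move/commgP/conjg_fixP: xhk; rewrite conjgM => /(congr1 (fun u => u ^ k)%g).
  by rewrite conjgKV.
by rewrite sumr_const card_rcoset mulr_natl.
Qed.

Definition pair_weight (zeta : nat -> algC) n (x g : 'S_n) : algC :=
  omega_val zeta x g *+ (g \in 'C[x]%g).

(** In the formula for induced characters, [omega_valJ] moves the conjugation from g to x; each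
    conjugate of x then occurs as often as the order of its centralizer, which cancels the
    denominator. *)
Lemma psiE zeta (zetaP : prim_root_family zeta) n (la nu : intpart n) :
  psi zetaP la nu =
  \sum_(x | has_cycle_type x la) pair_weight zeta x (perm_of_type nu).
Proof.
rewrite /psi /higher_lie cfIndE ?subsetT //.
set x := perm_of_type la; set g := perm_of_type nu.
transitivity (#|'C[x]%g|%:R^-1 * \sum_(h : 'S_n) pair_weight zeta (x ^ h)%g g).
  congr (_ * _); rewrite (reindex_inj (@invg_inj _)) /=.
  apply: eq_big => [h|h _]; first by rewrite inE.
  rewrite cfunElock /pair_weight.
  have -> : (g \in 'C[x ^ h])%g = (g ^ h^-1 \in 'C[x])%g by rewrite cent1J mem_conjg.
  case: (boolP (_ \in _)) => // gh; rewrite !mulr1n.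
  by rewrite -[in RHS](conjgKV h g) omega_valJ.
rewrite (sum_conjugates x (fun u => pair_weight zeta u g)) mulKf; last by rewrite pnatr_eq0 -lt0n cardG_gt0.
by apply: eq_bigl => y; rewrite has_cycle_type_class.
Qed.

Fact is_intpart_cycle_lengths n (x : 'S_n) : is_intpart n (sort geq (cycle_lengths x)).
Proof.
apply/and3P; split; first by apply: sort_sorted => i j; apply: leq_total.
  by rewrite mem_sort cycle_lengths_gt0.
by rewrite (perm_sumn (permEl (perm_sort _ _))) sumn_cycle_lengths.
Qed.

Definition cycle_type n (x : 'S_n) : intpart n := IntPart (is_intpart_cycle_lengths x).

Lemma has_cycle_typeE n (x : 'S_n) (la : intpart n) :
  has_cycle_type x la = (cycle_type x == la).
Proof.
rewrite /has_cycle_type -/(cycle_lengths x) -val_eqE /=.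
have geq_trans : transitive geq by move=> i j k ji kj; apply: leq_trans kj ji.
have geq_anti : antisymmetric geq by move=> i j; rewrite andbC => /anti_leq.
have geq_total : total geq by move=> i j; apply: leq_total.
have la_sorted : sorted geq la by case: (la) => s /= /and3P[].
rewrite -{2}(sorted_sort geq_trans la_sorted); apply/idP/eqP.
  by move/(perm_sortP geq_total geq_trans geq_anti).
by move/(perm_sortP geq_total geq_trans geq_anti).
Qed.

(** * Partitions in [EP n] as conditions on the cycles of [x] *)

Section EPSum.
Variables (zeta : nat -> algC) (zetaP : prim_root_family zeta) (n : nat).

Lemma sum_psi_EP (nu : intpart n) :
  \sum_(la in EP n) psi zetaP la nu =
  \sum_(x : 'S_n) (cycle_type x \in EP n)%:R * pair_weight zeta x (perm_of_type nu).
Proof.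
under [RHS]eq_bigr => x _ do rewrite mulr_natl mulrb.
rewrite -[RHS]big_mkcond /=.
rewrite [RHS](partition_big (@cycle_type n) (mem (EP n))) //=.
apply: eq_bigr => la laE; rewrite psiE; apply: eq_bigl => x.
by rewrite has_cycle_typeE; case: eqP => [->|]; rewrite ?laE ?andbF.
Qed.

Lemma odd_sumn (s : seq nat) : odd (sumn s) = odd (count odd s).
Proof. by elim: s => //= k s IHs; rewrite oddD IHs oddD; case: (odd k). Qed.

(** The number of odd parts has the parity of n, so the two indicators exclude each other and select
    the right case of [EP] by themselves. *)
Lemma mem_EPE (la : intpart n) :
  (la \in EP n)%:R = (all (fun j => ~~ odd j) la)%:R +
    ((nparts 1 la == 1%N) && all (fun j => (j == 1%N) || ~~ odd j) la)%:R :> algC.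
Proof.
have sum_la : sumn la = n by case: (la) => s /= /and3P[_ _ /eqP].
rewrite inE; case: (boolP (all _ la)) => [ev|nev].
  have cnt : count odd la = 0%N.
    by apply/eqP; rewrite eqn0Ngt -has_count -all_predC.
  have n_even : odd n = false by rewrite -sum_la odd_sumn cnt.
  have -> : nparts 1 la = 0%N.
    apply/count_memPn; apply: contraL ev => la1; apply/allPn.
    by exists 1%N.
  by rewrite n_even addr0.
rewrite add0r; case: ifP => // n_even.
case: eqP => //= np1; case: (boolP (all _ la)) => // al.
have cnt : count odd la = nparts 1 la.
  by apply: eq_in_count => j /(allP al) /=; case: eqP => [->|_ /= /negPf].
by move: n_even; rewrite -sum_la odd_sumn cnt np1.
Qed.

Variable g : 'S_n.

(** The single part 1 is a point y, the only one on an odd cycle. At most one y qualifies, so the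
    indicator is a sum over y, which can later be exchanged with the sum over x. *)
Lemma EP_weight (x : 'S_n) :
  (cycle_type x \in EP n)%:R = [forall r, ~~ odd (ord x r)]%:R +
  \sum_y ((x y == y) && [forall r, (r != y) ==> ~~ odd (ord x r)])%:R :> algC.
Proof.
have fixE y : (x y == y) = (ord x y == 1%N).
  by rewrite -[x y]/(iter 1 x y) iter_perm_id dvdn1.
rewrite mem_EPE /= !(perm_all _ (permEl (perm_sort _ _))) !all_cycle_lengths.
congr (_ + _).
have -> : nparts 1 (sort geq (cycle_lengths x)) = #|[set y | ord x y == 1%N]|.
  by rewrite /nparts (seq.permP (permEl (perm_sort _ _))) count_cycle_lengths muln1.
have [y0 /andP[y0f /forallP y0P]|none] :=
  pickP (fun y => (x y == y) && [forall r, (r != y) ==> ~~ odd (ord x r)]).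
  rewrite (bigD1 y0) //= y0f; have -> : [forall r, (r != y0) ==> ~~ odd (ord x r)].
    by apply/forallP.
  rewrite big1 => [|y yy0]; last first.
    have := y0P y; rewrite yy0 fixE /=; case: eqP => // ->.
    by [].
  rewrite addr0; have -> : [set y | ord x y == 1%N] = [set y0].
    apply/setP => y; rewrite !inE; have [->|yy0] := eqVneq y y0; first by rewrite -fixE y0f.
    by have := y0P y; rewrite yy0; case: eqP => // ->.
  rewrite cards1 eqxx /=; have -> // : [forall r, (ord x r == 1%N) || ~~ odd (ord x r)].
  apply/forallP => r; have [->|rr] := eqVneq r y0; first by rewrite -fixE y0f.
  by have := y0P r; rewrite rr => /= ->; rewrite orbT.
rewrite big1 => [|y _]; last by rewrite none.
case: eqP => //= /eqP/cards1P[y0 fixes]; case: forallP => // al.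
have y0f : ord x y0 == 1%N by have := set11 y0; rewrite -fixes inE.
have := none y0; rewrite fixE y0f /= => /forallP[] r; apply/implyP => ry.
have := al r; case: (boolP (ord x r == 1%N)) => //= r1.
have : r \in [set y0] by rewrite -fixes inE.
by rewrite inE (negPf ry).
Qed.

Lemma even_weight_allE (x : 'S_n) (U : {set 'I_n}) : stable_set x U ->
  even_weight zeta x g U = [forall r in U, ~~ odd (ord x r)]%:R *
    \prod_(r in U | froots x r) zeta (ord x r) ^+ cshift x g r.
Proof.
move=> xU; rewrite /even_weight big_split /=; congr (_ * _).
case: (boolP [forall r in U, _]) => [/forall_inP al|/forall_inPn[r rU odd_r]].
  by rewrite big1 // => r /andP[rU _]; rewrite al.
rewrite (bigD1 (froot x r)) /=; last first.
  by rewrite froots_froot (stable_fconnect xU (connect_root _ r)) rU.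
by rewrite order_froot (negPf odd_r) mul0r.
Qed.

Lemma even_sumT :
  even_sum zeta g [set: 'I_n] =
  \sum_(x | g \in 'C[x]%g) [forall r, ~~ odd (ord x r)]%:R * omega_val zeta x g.
Proof.
apply: eq_big => [x|x _].
  by rewrite centralizer_onE andbC (_ : perm_on _ _) //; apply/subsetP => y; rewrite inE.
rewrite even_weight_allE; last by move=> y; rewrite !inE.
congr (_%:R * _); first by congr nat_of_bool; apply: eq_forallb => r; rewrite inE.
by apply: eq_bigl => r; rewrite inE.
Qed.

Lemma even_sum_fix y : g y = y ->
  even_sum zeta g ([set: 'I_n] :\: gcycle g y) =
  \sum_(x | g \in 'C[x]%g)
     ((x y == y) && [forall r, (r != y) ==> ~~ odd (ord x r)])%:R * omega_val zeta x g.
Proof.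
move=> gy; have -> : [set: 'I_n] :\: gcycle g y = [set~ y].
  apply/setP => z; rewrite !inE andbT; congr (~~ _).
  apply/fconnect_iterP/eqP => [[j ->]|->]; last by exists 0%N.
  by elim: j => //= j ->.
rewrite [RHS]big_mkcond [LHS]big_mkcond /=; apply: eq_bigr => x _.
rewrite centralizer_onE; case: ifP => [/andP[-> x_on]|].
  have xy : x y = y by apply: (out_perm x_on); rewrite !inE eqxx.
  rewrite xy eqxx /= even_weight_allE; last exact: perm_on_stable.
  congr (_%:R * _); first by congr nat_of_bool; apply: eq_forallb => r; rewrite !inE.
  have xy1 : ord x y = 1%N by apply/eqP; rewrite -dvdn1 -iter_perm_id /= xy.
  have ry : froots x y.
    have := froot_connect x y; rewrite perm_fconnect_sym => /fconnect_iterP[j].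
    by move=> rE; rewrite froot_id_iff rE; apply/eqP; elim: j {rE} => //= j ->.
  rewrite /omega_val [RHS](bigD1 y) //= xy1.
  have -> : zeta 1%N = 1 by have := prim_expr_order (zetaP (ltn0Sn 0)); rewrite expr1.
  rewrite expr1n mul1r; apply: eq_bigl => r.
  by rewrite !inE andbC.
case: (boolP (g \in _)) => //= xg /negbT x_on; case: eqP => [xy|]; last by rewrite mul0r.
case/negP: x_on; apply/subsetP => z; rewrite !inE.
by apply: contra => /eqP ->; rewrite xy.
Qed.

Lemma sum_EP_pair_weight :
  \sum_(x : 'S_n) (cycle_type x \in EP n)%:R * pair_weight zeta x g =
  even_sum zeta g [set: 'I_n] +
  \sum_(y | g y == y) even_sum zeta g ([set: 'I_n] :\: gcycle g y).
Proof.
have -> : \sum_(x : 'S_n) (cycle_type x \in EP n)%:R * pair_weight zeta x g =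
  \sum_(x | g \in 'C[x]%g) (cycle_type x \in EP n)%:R * omega_val zeta x g.
  rewrite [RHS]big_mkcond; apply: eq_bigr => x _; rewrite /pair_weight.
  by case: (g \in _); rewrite // mulr0n mulr0.
under eq_bigr => x _ do rewrite EP_weight mulrDl mulr_suml.
rewrite big_split /= -even_sumT; congr (_ + _).
rewrite exchange_big /= [RHS]big_mkcond /=; apply: eq_bigr => y _.
case: eqP => [gy|gy]; first by rewrite even_sum_fix.
(* As x commutes with g and fixes y, it fixes g y too; if g y differs from y, then y is not the only
   point on an odd cycle. *)
rewrite big1 // => x xg; case: (boolP (_ && _)) => [|_]; last by rewrite mul0r.
case/andP=> /eqP xy /forallP/(_ (g y)); rewrite (introN eqP) //=.
have -> : ord x (g y) = 1%N.
  by apply/eqP; rewrite (order_cent _ xg) -dvdn1 -iter_perm_id /= xy.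
by [].
Qed.

End EPSum.

(** * Power series *)

Lemma polyXn_dvd (R : nzRingType) (p : {poly R}) d :
  (forall k, (k < d)%N -> p`_k = 0) -> exists u, p = 'X^d * u.
Proof.
move=> p0; exists (drop_poly d p); rewrite -commr_polyXn -[LHS](poly_take_drop d).
rewrite (_ : take_poly d p = 0) ?add0r //; apply/polyP => k.
by rewrite coef_take_poly coef0; case: ifP => // /p0.
Qed.

(* If D = (1 - X^2) P' - P / l vanishes to order d, then so does (1 + X) U' - U, where
   U = P^(2l) (1 - X); the only series with U' (1 + X) = U and U(0) = 1 is 1 + X. *)
Lemma poly_root_coef (l d : nat) : (0 < l)%N ->
  exists u, (\poly_(i < d) root_coef l i) ^+ (2 * l) * (1 - 'X) = 1 + 'X + 'X^d * u.
Proof.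
move=> l_gt0; case: d => [|d].
  set W := _ * (1 - 'X); exists (W - (1 + 'X)).
  by rewrite expr0 mul1r addrC subrK.
have l0 : l%:R != 0 :> algC by rewrite pnatr_eq0 -lt0n.
set P := \poly_(i < _) _.
have Pk k : (k <= d)%N -> P`_k = root_coef l k by rewrite -ltnS coef_poly => ->.
have [D DE] : exists D, (1 - 'X^2) * P^`() - l%:R^-1 *: P = 'X^d * D.
  apply: polyXn_dvd => k kd; rewrite mulrBl mul1r !coefB coefZ coefXnM !coef_deriv.
  rewrite (Pk k (ltnW kd)) (Pk k.+1 kd); case: k kd => [|[|k]] kd.
  - by rewrite /= mulr1n subr0 mulr1 subrr.
  - by rewrite subr0 -[root_coef _ _ *+ _]mulr_natl (root_coefS 0 l_gt0) mul0r addr0 mulrC subrr.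
  rewrite -[(k.+2 - 2)%N]/(k - 0)%N subn0 Pk; last by lia.
  rewrite -[root_coef l k.+3 *+ _]mulr_natl -[root_coef l k.+1 *+ _]mulr_natl.
  by rewrite (root_coefS k.+1 l_gt0) /= addrK mulrC subrr.
pose U := P ^+ (2 * l) * (1 - 'X).
have lE : (2 * l)%N = (2 * l).-1.+1 by lia.
have UE : (1 + 'X) * U^`() - U = 'X^d * (D * P ^+ (2 * l).-1 * (2 * l)%:R%:P).
  have PP : P ^+ (2 * l) = P ^+ (2 * l).-1 * P by rewrite -exprSr -lE.
  have -> : (1 + 'X) * U^`() = (2 * l)%:R * P ^+ (2 * l).-1 * ((1 - 'X^2) * P^`())
      - (1 + 'X) * P ^+ (2 * l).
    rewrite /U derivM derivB derivX derivC deriv_exp -mulr_natl; ring.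
  have -> : (1 - 'X^2) * P^`() = 'X^d * D + l%:R^-1 *: P by rewrite -DE subrK.
  have -> : (2 * l)%:R * P ^+ (2 * l).-1 * ('X^d * D + l%:R^-1 *: P) =
      'X^d * (D * P ^+ (2 * l).-1 * (2 * l)%:R%:P) + 2%:R * P ^+ (2 * l).
    have lV : l%:R * l%:R^-1%:P = 1 :> {poly algC} by rewrite -polyC_natr -polyCM divff.
    rewrite mulrDr PP -mul_polyC polyC_natr natrM.
    transitivity ('X^d * (D * P ^+ (2 * l).-1 * (2%:R * l%:R)) +
      2%:R * (l%:R * l%:R^-1%:P) * (P ^+ (2 * l).-1 * P)); first by ring.
    by rewrite lV mulr1.
  by rewrite /U; ring.
have U0 : U`_0 = 1.
  rewrite /U mulrBr mulr1 coefB coefMX subr0 -horner_coef0 horner_exp horner_coef0.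
  by rewrite Pk // expr1n.
(* At k = 0 this gives U_1 = U_0 = 1, at k = 1 it gives U_2 = 0, and the later coefficients vanish
   in turn. *)
have Uk k : (k < d)%N -> k.+1%:R * U`_k.+1 = (1 - k%:R) * U`_k.
  move=> kd; have := congr1 (fun p : {poly algC} => p`_k) UE.
  rewrite /= coefB mulrDl mul1r coefD coefXM coefXnM kd !coef_deriv.
  move/eqP; rewrite subr_eq0 mulrBl mul1r; case: k kd => [|k] kd /eqP /= E.
    by rewrite -E addr0 mulr1n mul0r subr0 mul1r.
  by rewrite -{1}E -[U`_k.+2 *+ _]mulr_natl -[U`_k.+1 *+ _]mulr_natl addrK.
have [u uE] : exists u : {poly algC}, U - (1 + 'X) = 'X^(d.+1) * u.
  apply: polyXn_dvd => k kd; rewrite coefB coefD coefX coef1.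
  case: k kd => [|[|k]] kd; first by rewrite U0 addr0 subrr.
    by have := Uk 0%N kd; rewrite mul1r subr0 mul1r U0 => ->; rewrite add0r subrr.
  rewrite addr0 subr0; elim: k kd => [|k IHk] kd.
    have /eqP := Uk 1%N kd; rewrite subrr mul0r mulf_eq0 pnatr_eq0 /= => /eqP.
    by [].
  have /eqP := Uk k.+2 kd; rewrite IHk ?mulr0 ?mulf_eq0 ?pnatr_eq0 /=; last by lia.
  by move/eqP.
by exists u; rewrite -uE [RHS]addrC subrK.
Qed.

Section FpsCoef.
Variable I : choiceType.
Local Notation F := (fps I algC).
Local Notation M := {cmonom I}.
Implicit Types (f g h : F) (m a b : M).

Lemma fps_coefM f g m : (f * g) m = \sum_(p <- mfact m) f p.1 * g p.2.
Proof. by []. Qed.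

Lemma fps_coefD f g m : (f + g) m = f m + g m. Proof. by []. Qed.
Lemma fps_coefZ c f m : (c *: f) m = c * f m. Proof. by []. Qed.
Lemma fps_coef1 m : (1 : F) m = (m == 1%M)%:R. Proof. by []. Qed.

Lemma fps_coef_sum (J : Type) (r : seq J) (P : pred J) (G : J -> F) m :
  (\sum_(j <- r | P j) G j) m = \sum_(j <- r | P j) G j m.
Proof. exact: (big_morph (fun f : F => f m)). Qed.

Lemma fps_coef1M f g : (f * g) 1%M = f 1%M * g 1%M.
Proof.
rewrite fps_coefM (bigD1_seq (1%M, 1%M)) ?mfact_uniq ?mem_mfact ?mul1m //=.
rewrite big_seq_cond big1 ?addr0 // => -[a b] /andP[].
by rewrite mem_mfact /= => /eqP/unitm[-> ->]; rewrite eqxx.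
Qed.

Lemma fps_coef1X f k : (f ^+ k) 1%M = f 1%M ^+ k.
Proof. by elim: k => [|k IHk]; rewrite ?fps_coef1 ?eqxx // !exprS fps_coef1M IHk. Qed.

Lemma fps_mulI f g : f 1%M != 0 -> f * g = 0 -> g = 0.
Proof.
move=> f1 fg; apply/fpsP => m; have [d] := ubnP (mdeg m); elim: d m => // d IHd m le_m.
have : (f * g) m = 0 by rewrite fg.
rewrite fps_coefM (bigD1_seq (1%M, m)) ?mfact_uniq ?mem_mfact ?mul1m //=.
rewrite big_seq_cond big1 ?addr0 => [/eqP|[a b] /andP[]].
  by rewrite mulf_eq0 (negPf f1) => /eqP.
rewrite mem_mfact /= => /eqP ab ne; rewrite IHd ?mulr0 //.
have a1 : a != 1%M by apply: contra ne => /eqP a1; rewrite -ab a1 mul1m.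
by move: le_m; rewrite -ab mdegM -mdeg_eq0 in a1 *; lia.
Qed.

(** The cofactor of f - g in f^k - g^k has constant term k, which is nonzero, so it can be
    cancelled. *)
Lemma fps_root_unique k f g : (0 < k)%N -> f 1%M = 1 -> g 1%M = 1 ->
  f ^+ k = g ^+ k -> f = g.
Proof.
move=> k_gt0 f1 g1 /eqP; rewrite -subr_eq0 subrXX mulrC => /eqP/fps_mulI fg.
apply/eqP; rewrite -subr_eq0; apply/eqP/fg.
rewrite fps_coef_sum (eq_bigr (fun=> 1)) => [|i _].
  by rewrite sumr_const card_ord pnatr_eq0 -lt0n.
by rewrite fps_coef1M !fps_coef1X f1 g1 !expr1n mulr1.
Qed.

Lemma fps_rootE k f g : (0 < k)%N -> g 1%M = 1 -> g ^+ k = f -> fps_root k f = g.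
Proof.
move=> k_gt0 g1 gk; rewrite /fps_root; case: boolp.pselect => [e|[]]; last by exists g.
case: boolp.cid => h /= [h1 hk]; apply: (fps_root_unique k_gt0 h1 g1).
by rewrite hk gk.
Qed.

Lemma fpsmonoM a b : fpsmono algC a * fpsmono algC b = fpsmono algC (a * b)%M.
Proof.
apply/fpsP => m; rewrite fps_coefM /=; case: (eqVneq m (a * b)%M) => [->|m_ne].
  rewrite (bigD1_seq (a, b)) ?mfact_uniq ?mem_mfact //= !eqxx mulr1.
  rewrite big1 ?addr0 // => -[a' b'] /= ne.
  by rewrite -natrM mulnb -xpair_eqE (negPf ne).
rewrite big_seq big1 // => -[a' b']; rewrite mem_mfact /= => /eqP ab.
by rewrite -natrM mulnb; case: eqP => //= a'a; case: eqP => //= b'b; rewrite -ab a'a b'b eqxx in m_ne.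
Qed.

(** Congruence modulo the series of order at least d in total degree; it lets polynomials stand for
    series. *)
Definition eq_upto d f g := forall m, (mdeg m < d)%N -> f m = g m.

Lemma eq_uptoM d f f' g g' : eq_upto d f f' -> eq_upto d g g' -> eq_upto d (f * g) (f' * g').
Proof.
move=> ff gg m md; rewrite !fps_coefM !big_seq; apply: eq_bigr => -[a b].
rewrite mem_mfact /= => /eqP ab; move: md; rewrite -ab mdegM => md.
by rewrite ff ?gg //; lia.
Qed.

Lemma eq_uptoX d f f' k : eq_upto d f f' -> eq_upto d (f ^+ k) (f' ^+ k).
Proof. by move=> ff; elim: k => // k IHk; rewrite !exprS; apply: eq_uptoM. Qed.

Variable j : I.
Let t : F := fpsmono algC (ucm j).

Definition var_power (e : nat) : M := iter e (mmul (ucm j)) 1%M.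

Lemma var_powerE (b : nat) i : var_power b i = ((j == i) * b)%N.
Proof.
elim: b => [|b IHb]; first by rewrite cm1 muln0.
by rewrite /= cmM -/(var_power b) IHb cmU mulnS.
Qed.

Lemma mdeg_var_power (b : nat) : mdeg (var_power b) = b.
Proof. by elim: b => [|b IHb]; rewrite ?mdeg1 // /= mdegM mdegU -/(var_power b) IHb. Qed.

Lemma fpsmono_var_power (b : nat) : fpsmono algC (var_power b) = t ^+ b.
Proof. by elim: b => // b IHb; rewrite exprS -IHb fpsmonoM. Qed.

(** The one-variable series with coefficients q, placed in the variable j; the test says that m is a
    pure power of that variable. *)
Definition var_series (q : nat -> algC) : F :=
  Fps (fun m => if m == var_power (m j) then q (m j) else 0).

Lemma var_series_1 q : var_series q 1%M = q 0%N.
Proof. by rewrite /= cm1 eqxx. Qed.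

Lemma var_series_upto q d :
  eq_upto d (var_series q) (horner_alg t (\poly_(i < d) q i)).
Proof.
have alg_mono i : horner_alg t (q i *: 'X^i) = q i *: fpsmono algC (var_power i).
  by rewrite linearZ /= rmorphXn /= horner_algX fpsmono_var_power mulr_algl.
move=> m md; rewrite poly_def linear_sum /=.
under eq_bigr => i _ do rewrite alg_mono.
rewrite fps_coef_sum; under eq_bigr => i _ do rewrite fps_coefZ.
rewrite /=.
case: eqP => [mE|mE].
  have mjd : (m j < d)%N by move: md; rewrite mE mdeg_var_power var_powerE eqxx mul1n.
  rewrite (bigD1 (Ordinal mjd)) //= -mE eqxx mulr1 big1 ?addr0 // => i ine.
  case: eqP => [mi|]; last by rewrite mulr0.
  by case/eqP: ine; apply: val_inj; rewrite /= mi var_powerE eqxx mul1n.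
rewrite big1 // => i _; case: eqP => [mi|]; last by rewrite mulr0.
by case: mE; rewrite {2}mi var_powerE eqxx mul1n.
Qed.

Lemma var_power_upto d h : eq_upto d (t ^+ d * h) 0.
Proof.
move=> m md; rewrite -fpsmono_var_power fps_coefM big_seq big1 // => -[a b].
rewrite mem_mfact /= => /eqP ab; case: eqP => [aE|]; last by rewrite mul0r.
by move: md; rewrite -ab mdegM aE mdeg_var_power; lia.
Qed.

Lemma eq_upto_all f g : (forall d, eq_upto d f g) -> f = g.
Proof. by move=> fg; apply/fpsP => m; apply: (fg (mdeg m).+1). Qed.

(** This reduces an identity of series to polynomial congruences modulo X^d for all d, which can be
    proved with formal derivatives. *)
Lemma var_series_poly (q : nat -> algC) (k : nat) (p r : {poly algC}) :
  (forall d, exists u, (\poly_(i < d) q i) ^+ k * p = r + 'X^d * u) ->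
  var_series q ^+ k * horner_alg t p = horner_alg t r.
Proof.
move=> pr; apply: eq_upto_all => d m md; have [u uE] := pr d.
have := eq_uptoM (eq_uptoX k (@var_series_upto q d)) (fun m _ => erefl (horner_alg t p m)) md.
have algD : horner_alg t (\poly_(i < d) q i) ^+ k * horner_alg t p = horner_alg t r + t ^+ d * horner_alg t u.
  have := congr1 (horner_alg t) uE.
  by rewrite rmorphM rmorphXn /= rmorphD rmorphM /= rmorphXn /= horner_algX.
move=> ->; rewrite algD.
by rewrite fps_coefD (var_power_upto _ md) addr0.
Qed.

Lemma unit_sub1 : (1 - t) \is a GRing.unit.
Proof.
apply/unitrPr; exists (var_series (fun=> 1)).
rewrite mulrC.
have -> : 1 - t = horner_alg t (1 - 'X) by rewrite rmorphB /= rmorph1 horner_algX.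
rewrite -[var_series _]expr1 (@var_series_poly _ _ _ 1) ?rmorph1 // => d.
exists (-1); rewrite expr1 mulrN mulr1.
transitivity ((1 - 'X) * \sum_(i < d) 'X^i : {poly algC}).
  by rewrite poly_def mulrC; congr (_ * _); apply: eq_bigr => i _; rewrite scale1r.
by rewrite -[1 - 'X]opprB mulNr -subrX1 opprB.
Qed.

Lemma root_coef_seriesX (l : nat) : (0 < l)%N ->
  var_series (root_coef l) ^+ (2 * l) = (1 + t) / (1 - t).
Proof.
move=> l_gt0; apply: (mulIr unit_sub1); rewrite divrK ?unit_sub1 //.
have tE : 1 + t = horner_alg t (1 + 'X) by rewrite rmorphD /= rmorph1 horner_algX.
have -> : 1 - t = horner_alg t (1 - 'X) by rewrite rmorphB /= rmorph1 horner_algX.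
by rewrite tE; apply: var_series_poly => d; apply: poly_root_coef.
Qed.

Lemma fps_root_binomial (l : nat) : (0 < l)%N ->
  fps_root (2 * l) ((1 + t) / (1 - t)) = var_series (root_coef l).
Proof.
move=> l_gt0; apply: fps_rootE; [by rewrite muln_gt0 l_gt0 | exact: var_series_1 |].
exact: root_coef_seriesX.
Qed.

Lemma var_series_delta (q : nat -> algC) : (forall e, q e = (e == 0%N)%:R) -> var_series q = 1.
Proof.
move=> q0; apply/fpsP => m; rewrite fps_coef1 /= q0.
case: (eqVneq m 1%M) => [->|m1]; first by rewrite cm1 !eqxx.
case: eqP => // mE; case: eqP => // mj; case/eqP: m1.
by rewrite mE mj.
Qed.

(** As f does not involve the variable j, the second factor must carry the full power of it, so one
    factorization of m contributes. *)
Lemma fps_coefM_var_series f (q : nat -> algC) m :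
  (forall a, a j != 0%N -> f a = 0) ->
  (f * var_series q) m = f (divcm m (var_power (m j))) * q (m j).
Proof.
move=> fj; set a0 := divcm _ _; set b0 := var_power (m j).
have a0j : a0 j = 0%N by rewrite divcmE var_powerE eqxx mul1n subnn.
have b0j : b0 j = m j by rewrite var_powerE eqxx mul1n.
have ab0 : (a0 * b0)%M = m.
  apply/eqP/cmP => i; rewrite cmM divcmE var_powerE.
  by case: eqP => [->|_]; rewrite ?mul1n ?subnn ?mul0n ?subn0 ?addn0.
rewrite fps_coefM (bigD1_seq (a0, b0)) ?mfact_uniq ?mem_mfact ?ab0 //=.
rewrite b0j eqxx big_seq_cond big1 ?addr0 // => -[a b] /andP[].
rewrite mem_mfact /= => /eqP ab ne.
have [aj|aj] := eqVneq (a j) 0%N; last by rewrite fj ?mul0r.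
have bj : b j = m j by rewrite -ab cmM aj.
rewrite bj; case: eqP => [bE|]; last by rewrite mulr0.
have b0E : b0 = b by rewrite bE.
case/eqP: ne; rewrite b0E; congr (_, _); apply/eqP/cmP => i.
by rewrite /a0 -/b0 b0E divcmE -ab cmM addnK.
Qed.

End FpsCoef.

(** A trivial factor is inserted for each l that is not a power of 2, so that the product runs over
    all cycle lengths. *)
Definition pow2_coef (l b : nat) : algC :=
  if (2.-nat l)%N then root_coef l b else (b == 0%N)%:R.

Lemma pow2_coef0 l : pow2_coef l 0 = 1.
Proof. by rewrite /pow2_coef; case: ifP. Qed.

(** * Coefficients of the infinite product *)

Section InfiniteProduct.
Local Notation M := {cmonom nat}.
Implicit Type m : M.

Lemma coef_prod_var_series (K : nat) m :
  (\prod_(1 <= l < K.+1) var_series l.-1 (pow2_coef l)) m =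
  (all (fun i => i < K)%N (finsupp m))%:R * \prod_(1 <= l < K.+1) pow2_coef l (m l.-1).
Proof.
elim: K m => [|K IHK] m.
  rewrite !big_geq // mulr1 fps_coef1; congr (_%:R); congr nat_of_bool.
  apply/eqP/allP => [-> i|supp]; first by rewrite -cmE_neq0 cm1.
  apply/eqP/cmP => i; rewrite cm1; apply/eqP; apply: contraT; rewrite cmE_neq0.
  by move/supp.
have IHK0 (a : M) : a K != 0%N -> (\prod_(1 <= l < K.+1) var_series l.-1 (pow2_coef l)) a = 0.
  rewrite IHK cmE_neq0 => aK; case: allP => [/(_ K aK)|_]; last by rewrite mul0r.
  by rewrite ltnn.
rewrite !(@big_nat_recr _ _ _ K.+1) // -[K.+1.-1]/K fps_coefM_var_series // IHK mulrA.
set m' := divcm _ _.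
have m'E i : m' i = if i == K then 0%N else m i.
  rewrite divcmE var_powerE eq_sym; case: eqP => [->|_]; first by rewrite mul1n subnn.
  by rewrite mul0n subn0.
congr (_ * _ * _).
  congr (_%:R); congr nat_of_bool; apply/allP/allP => supp i.
    rewrite -cmE_neq0 => mi; have [->//|iK] := eqVneq i K.
    by apply: ltnW; apply: supp; rewrite -cmE_neq0 m'E (negPf iK).
  rewrite -cmE_neq0 m'E; case: (eqVneq i K) => //= iK.
  by rewrite cmE_neq0 => /supp; rewrite ltnS leq_eqVlt (negPf iK).
rewrite !big_nat; apply: eq_bigr => l /andP[l_gt0 lK]; rewrite m'E.
by case: eqP => // lE; move: lK; rewrite -lE; lia.
Qed.

Lemma pow2_nat p : (2.-nat (2 ^ p))%N.
Proof. by rewrite pnatX. Qed.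

Lemma prod_var_series_pow2 N :
  \prod_(p < N) var_series (2 ^ p).-1 (root_coef (2 ^ p)) =
  \prod_(1 <= l < 2 ^ N) var_series l.-1 (pow2_coef l) :> fps nat algC.
Proof.
elim: N => [|N IHN]; first by rewrite big_ord0 big_geq.
have gt0 : (0 < 2 ^ N)%N by rewrite expn_gt0.
have lt : (2 ^ N < 2 ^ N.+1)%N by rewrite ltn_exp2l.
rewrite big_ord_recr IHN /= (@big_cat_nat _ _ _ (2 ^ N) _ (2 ^ N.+1)) ?(ltnW lt) //=.
congr (_ * _); rewrite (big_ltn lt) big_nat big1 ?mulr1 => [|l /andP[l_gt l_lt]].
  by congr var_series; apply/boolp.funext => b; rewrite /pow2_coef pow2_nat.
apply: var_series_delta => b; rewrite /pow2_coef ifF //.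
apply/negP => /p_natP[k lE]; move: l_gt l_lt; rewrite lE ltn_exp2l // ltn_exp2l //.
by lia.
Qed.

(** Variable number i is t_(i+1), hence the parts [i.+1]. The sum of these parts is the weight of m,
    the only n whose partitions can produce m. *)
Definition parts_of m : seq nat := flatten [seq nseq (m i) i.+1 | i <- finsupp m].

Lemma count_parts_of m i : count_mem i.+1 (parts_of m) = m i.
Proof.
rewrite count_flatten -map_comp sumnE big_map.
have [im|im] := boolP (i \in finsupp m).
  rewrite (bigD1_seq i) ?fset_uniq //= count_nseq /= eqxx mul1n big1 ?addn0 // => k ki.
  by rewrite count_nseq /= eqSS (negPf ki).
have := im; rewrite -cmE_eq0 => /eqP ->; rewrite big_seq big1 // => k km.
rewrite /= count_nseq /= eqSS; case: eqP => // ki.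
by rewrite -ki km in im.
Qed.

Lemma parts_of_gt0 m : 0%N \notin parts_of m.
Proof. by apply/flatten_mapP => -[i _]; rewrite mem_nseq andbC. Qed.

Lemma mem_leq_sumn (s : seq nat) k : k \in s -> (k <= sumn s)%N.
Proof.
elim: s => //= a s IHs; rewrite inE => /orP[/eqP ->|/IHs ks]; first exact: leq_addr.
exact: leq_trans ks (leq_addl _ _).
Qed.

Lemma mem_supp_leq m i : i \in finsupp m -> (i < sumn (parts_of m))%N.
Proof.
by rewrite -cmE_neq0 => mi; apply: mem_leq_sumn; rewrite -has_pred1 has_count count_parts_of lt0n.
Qed.

(** No l beyond the weight of m occurs in m, and such an l would contribute [pow2_coef l 0], which
    is 1. *)
Definition limit_coef m : algC :=
  \prod_(1 <= l < (sumn (parts_of m)).+1) pow2_coef l (m l.-1).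

Lemma coef_prod_limit K m : (sumn (parts_of m) <= K)%N ->
  (\prod_(1 <= l < K.+1) var_series l.-1 (pow2_coef l)) m = limit_coef m.
Proof.
move=> mK; rewrite coef_prod_var_series (_ : all _ _); last first.
  by apply/allP => i /mem_supp_leq /leq_trans; apply.
rewrite mul1r (@big_cat_nat _ _ _ (sumn (parts_of m)).+1 _ K.+1) //=.
rewrite [X in _ * X]big_nat [X in _ * X]big1 ?mulr1 // => l /andP[lm _].
suff -> : m l.-1 = 0%N by rewrite pow2_coef0.
apply/eqP; apply: contraTT lm; rewrite cmE_neq0 => /mem_supp_leq.
by case: l => //= l; rewrite -ltnNge ltnS.
Qed.

End InfiniteProduct.

(** * Coefficients of the character sum *)

Section Coefficients.
Variables (n : nat) (nu : intpart n).

Lemma sumn_intpart : sumn nu = n.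
Proof. by case: (nu) => s /= /and3P[_ _ /eqP]. Qed.

Lemma mem_intpart l : l \in (nu : seq nat) -> (0 < l <= n)%N.
Proof.
move=> lnu; rewrite -{1}sumn_intpart mem_leq_sumn // andbT lt0n.
by apply: contraTneq lnu => ->; apply: intpart_gt0.
Qed.

Lemma prod_nparts (R : comNzRingType) (x : nat -> R) :
  \prod_(1 <= j < n.+1) x j ^+ nparts j nu = \prod_(l <- nu) x l.
Proof.
have : all (fun l => 0 < l <= n)%N nu by apply/allP => l; apply: mem_intpart.
elim: (nu : seq nat) => [_|a s IHs /= /andP[an /IHs IH]].
  by rewrite big_nil big1.
rewrite big_cons -IH (eq_bigr (fun j => (if a == j then x j else 1) * x j ^+ nparts j s)) => [|j _].
  rewrite big_split /=; congr (_ * _).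
  rewrite (bigD1_seq a) ?iota_uniq ?mem_index_iota //= eqxx big1 ?mulr1 // => j ja.
  by rewrite eq_sym (negPf ja).
by rewrite /nparts /= exprD; case: (a == j).
Qed.

Let g := perm_of_type nu.

Lemma sign_of_typeE : sign_of_type nu =
  \prod_(1 <= l < n.+1) ((-1) ^+ l.+1) ^+ nparts l nu :> algC.
Proof.
rewrite prod_nparts /sign_of_type.
have size_nu : #|porbits g| = size nu.
  by rewrite -(perm_size (perm_of_typeP nu)) size_map -cardE.
rewrite /odd_perm signr_addb card_ord size_nu !signr_odd -{1}sumn_intpart.
elim: (nu : seq nat) => [|a s IHs]; first by rewrite big_nil mulr1.
by rewrite big_cons -IHs /= exprD !exprS; ring.
Qed.

Lemma type_cycle_counts : has_cycle_counts g [set: 'I_n] (nparts ^~ nu).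
Proof.
move=> l l_gt0; have /has_cycle_typeP xla := perm_of_typeP nu.
rewrite -xla ?intpart_gt0 //; apply: eq_card => y; rewrite !inE.
by [].
Qed.

(** At l = 1 the second term counts the x with one isolated fixed point, which is chosen among the
    fixed points of g and removed. *)
Definition part_count (l : nat) : algC :=
  if l == 1%N then even_count 1 (nparts 1 nu) + (nparts 1 nu)%:R * even_count 1 (nparts 1 nu).-1
  else even_count l (nparts l nu).

Lemma sum_psi_EP_prod zeta (zetaP : prim_root_family zeta) :
  \sum_(la in EP n) psi zetaP la nu = \prod_(1 <= l < n.+1) part_count l.
Proof.
rewrite sum_psi_EP sum_EP_pair_weight // -/g.
have gT : stable_set g [set: 'I_n] by move=> y; rewrite !inE.
rewrite (even_sumE zetaP gT type_cycle_counts).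
have fix_sum y : g y == y -> even_sum zeta g ([set: 'I_n] :\: gcycle g y) =
   count_prod n (fun l => nparts l nu - (l == 1))%N.
  move=> gy; have oy : ord g y = 1%N.
    by apply/eqP; rewrite -dvdn1 -iter_perm_id.
  have := has_cycle_countsD gT type_cycle_counts (in_setT y); rewrite oy => cnt.
  apply: even_sumE cnt => //; apply: stableD => //; exact: stable_gcycle.
rewrite (eq_bigr _ fix_sum) (eq_bigl (fun y => y \in [set y | ord g y == 1%N])) => [|y]; last first.
  by rewrite inE -dvdn1 -iter_perm_id.
rewrite sumr_const.
have -> : #|[set y | ord g y == 1%N]| = nparts 1 nu.
  have := type_cycle_counts (ltn0Sn 0); rewrite muln1 => <-.
  by apply: eq_card => y; rewrite !inE.
(* For n = 0 the products are empty and have no factor at l = 1 to split off. *)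
have [n0|n_gt0] := posnP n.
  have nu1 : nparts 1 nu = 0%N.
    by apply/count_memPn; apply/negP => /mem_intpart; rewrite n0.
  by rewrite nu1 mulr0n addr0 /count_prod !big_geq ?n0.
have n1 : (0 < 1 <= n)%N by [].
rewrite !(@count_prodD1 _ _ 1) // subn1 /=.
have -> : count_prod' n (fun l => nparts l nu - (l == 1))%N 1 = count_prod' n (nparts ^~ nu) 1.
  by apply: eq_bigr => l /negPf ->; rewrite subn0.
rewrite -mulr_natl mulrA -mulrDl (bigD1_seq 1%N) ?iota_uniq ?mem_index_iota //=.
rewrite {1}/part_count eqxx; congr (_ * _); apply: eq_bigr => l l1.
by rewrite /part_count (negPf l1).
Qed.

Lemma EP_coefE zeta (zetaP : prim_root_family zeta) :
  \sum_(la in EP n) sign_of_type nu * psi zetaP la nu / (zcard nu)%:R =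
  \prod_(1 <= l < n.+1) pow2_coef l (nparts l nu).
Proof.
rewrite -mulr_suml -mulr_sumr sum_psi_EP_prod sign_of_typeE /zcard natr_prod.
rewrite -prodfV -!big_split /= !big_nat; apply: eq_bigr => l /andP[l_gt0 _].
set b := nparts l nu; have z0 : (b`! * l ^ b)%:R != 0 :> algC.
  by rewrite pnatr_eq0 -lt0n muln_gt0 fact_gt0 expn_gt0 l_gt0.
apply: (canLR (mulfK z0)); rewrite /part_count; case: eqP => [l1|/eqP l1].
  rewrite /b l1 expr2 mulN1r opprK expr1n mul1r even_count_1 exp1n muln1.
  by rewrite mulrC /pow2_coef.
rewrite -/b /pow2_coef; case: ifP => [l2|/negbT l2].
  have l_gt1 : (1 < l)%N by rewrite ltn_neqAle eq_sym l1.
  have l_even : odd l = false.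
    case/p_natP: l2 => k lE; rewrite lE in l_gt1 *; rewrite oddX orbF.
    by case: k {lE} l_gt1.
  rewrite even_count_pow2 // -signr_odd /= l_even expr1 -mulrA [RHS]mulrC !mulrA.
  by rewrite -exprMn mulN1r opprK expr1n mul1r.
rewrite even_count_not_pow2 //; case: (b) => [|b'] /=; rewrite ?mulr0 ?mul0r //.
Qed.

Definition type_monomial : {cmonom nat} := \big[mmul/1%M]_(l <- nu) ucm l.-1.

Lemma prod_tvar :
  \prod_(1 <= j < n.+1) tvar j ^+ nparts j nu = fpsmono algC type_monomial.
Proof.
rewrite prod_nparts /type_monomial; elim: (nu : seq nat) => [|a s IHs]; first by rewrite !big_nil.
by rewrite !big_cons IHs fpsmonoM.
Qed.

Lemma type_monomialE i : type_monomial i = nparts i.+1 nu.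
Proof.
rewrite /type_monomial /nparts; have := intpart_gt0 nu.
elim: (nu : seq nat) => [|a s IHs] nu0; first by rewrite big_nil cm1.
move: nu0; rewrite big_cons cmM inE negb_or => /andP[a0 /IHs ->] /=.
by rewrite cmU; case: a a0.
Qed.

Lemma type_monomial_eq (m : {cmonom nat}) :
  (type_monomial == m) = perm_eq nu (parts_of m).
Proof.
apply/cmP/idP => [mE|/seq.permP perm_nu i]; last first.
  by rewrite type_monomialE /nparts perm_nu count_parts_of.
apply/allP => -[|i] _ /=; last by rewrite count_parts_of -mE type_monomialE.
by rewrite !(count_memPn _) ?parts_of_gt0 ?intpart_gt0.
Qed.

End Coefficients.

Section Limit.
Variables (zeta : nat -> algC) (zetaP : prim_root_family zeta).
Local Notation M := {cmonom nat}.

(** A monomial determines its partition, namely the sorted [parts_of m], so at most one pair of n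
    and nu contributes to the coefficient. *)
Lemma coef_EP_term n (m : M) :
  (\sum_(la in EP n) \sum_(nu : intpart n)
     (sign_of_type nu * psi zetaP la nu / (zcard nu)%:R) *:
        \prod_(1 <= j < n.+1) tvar j ^+ nparts j nu) m =
  (n == sumn (parts_of m))%:R * limit_coef m.
Proof.
rewrite exchange_big /= fps_coef_sum.
have nuE (nu : intpart n) : (\sum_(la in EP n)
    (sign_of_type nu * psi zetaP la nu / (zcard nu)%:R) *:
        \prod_(1 <= j < n.+1) tvar j ^+ nparts j nu) m =
   (\prod_(1 <= l < n.+1) pow2_coef l (nparts l nu)) * (m == type_monomial nu)%:R.
  by rewrite -scaler_suml EP_coefE prod_tvar.
rewrite (eq_bigr _ (fun nu _ => nuE nu)).
have [nE|n_ne] := eqVneq n (sumn (parts_of m)); last first.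
  rewrite mul0r big1 // => nu _; rewrite eq_sym type_monomial_eq.
  case: (boolP (perm_eq _ _)) => [/perm_sumn|_]; last by rewrite mulr0.
  by rewrite sumn_intpart => nE; rewrite nE eqxx in n_ne.
have geq_trans : transitive geq by move=> i j k ji kj; apply: leq_trans kj ji.
have geq_anti : antisymmetric geq by move=> i j; rewrite andbC => /anti_leq.
have geq_total : total geq by move=> i j; apply: leq_total.
have nu0P : is_intpart n (sort geq (parts_of m)).
  apply/and3P; split; first exact: sort_sorted.
    by rewrite mem_sort parts_of_gt0.
  by rewrite (perm_sumn (permEl (perm_sort _ _))) nE.
pose nu0 := IntPart nu0P.
have monE (nu : intpart n) : (m == type_monomial nu) = (nu == nu0).
  rewrite eq_sym type_monomial_eq -val_eqE /=.
  have nu_sorted : sorted geq nu by case: (nu) => s /= /and3P[].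
  rewrite -[X in _ = (X == _)](sorted_sort geq_trans nu_sorted).
  apply/idP/eqP; first by move/(perm_sortP geq_total geq_trans geq_anti).
  by move/(perm_sortP geq_total geq_trans geq_anti).
rewrite (bigD1 nu0) //= monE eqxx mulr1 [X in _ + X]big1 ?addr0 => [|nu /negPf nu_ne]; last first.
  by rewrite monE nu_ne mulr0.
rewrite mul1r /limit_coef -nE !big_nat; apply: eq_bigr => l /andP[l_gt0 _].
have /eqP mE : m == type_monomial nu0 by rewrite monE.
by have -> : m l.-1 = nparts l nu0 by rewrite {1}mE type_monomialE prednK.
Qed.

End Limit.

Theorem theorem1p4 (zeta : nat -> algC) (zetaP : prim_root_family zeta) :
  exists S : fps nat algC,
    fps_cvg (fun N : nat =>
      \sum_(n < N) \sum_(la in EP n) \sum_(nu : intpart n)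
        (sign_of_type nu * psi zetaP la nu / (zcard nu)%:R) *:
          \prod_(1 <= j < n.+1) tvar j ^+ nparts j nu) S
    /\ fps_cvg (fun N : nat =>
      \prod_(p < N)
        fps_root (2 ^ p.+1)%N ((1 + tvar (2 ^ p)) / (1 - tvar (2 ^ p)))) S.
Proof.
(* Beyond the weight of m both coefficients are constant: the sum already contains its only
   contributing n, and the product over l < 2^N covers all variables of m because N < 2^N. *)
exists (Fps limit_coef); split=> m; exists (sumn (parts_of m)).+1 => N mN.
  rewrite fps_coef_sum; under eq_bigr => n _ do rewrite coef_EP_term.
  rewrite (bigD1 (Ordinal mN)) //= eqxx mul1r big1 ?addr0 // => n /eqP n_ne.
  by case: eqP => [nE|]; rewrite ?mul0r //; case: n_ne; apply: val_inj.
under eq_bigr => p _ do rewrite expnS fps_root_binomial ?expn_gt0 //.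
rewrite prod_var_series_pow2 -(prednK (_ : 0 < 2 ^ N)%N) ?expn_gt0 //.
rewrite coef_prod_limit // -ltnS prednK ?expn_gt0 //.
exact: ltn_trans mN (ltn_expl _ _).
Qed.
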